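(* If $f$ is presented as a Boolean circuit of size $\mathrm{poly}(\log n, k)$, then for $k \ge 3$ there is an algorithm for the $k$-dimensional \textsc{Tarski} problem that runs in time $O(\mathrm{poly}(\log n, k) \cdot \log(n)^{k-1})$.
   Context: For positive integers $n_1,\dots,n_k$, the lattice $L = L(n_1,\dots,n_k)$ is the set of all $x \in \mathbb{N}^k$ with $1 \le x_i \le n_i$, ordered by $x \preceq y$ iff $x_i \le y_i$ for all $i$; $n = \max_i n_i$. The \textsc{Tarski} problem: given $f : L \to L$, find either (T1) $x \in L$ with $f(x)=x$, or (T2) $x, y \in L$ with $x \preceq y$ and $f(x) \not\preceq f(y)$. *)

(* Defs.v *)
From HB Require Import structures.
From mathcomp Require Import all_boot all_order all_algebra.
From mathcomp Require Import reals exp.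

Set Implicit Arguments.
Unset Strict Implicit.
Unset Printing Implicit Defensive.

Import Order.TTheory GRing.Theory Num.Theory.

Definition in_lattice (k : nat) (ns x : k.-tuple nat) : bool :=
  [forall i : 'I_k, 1 <= tnth x i <= tnth ns i].

Definition lattice (k : nat) (ns : k.-tuple nat) : Type :=
  {x : k.-tuple nat | in_lattice ns x}.

Definition lattice_le (k : nat) (ns : k.-tuple nat) (x y : lattice ns) : Prop :=
  forall i : 'I_k, tnth (sval x) i <= tnth (sval y) i.

Definition side (k : nat) (ns : k.-tuple nat) : nat :=
  \max_(i < k) tnth ns i.

Inductive answer (k : nat) (ns : k.-tuple nat) : Type :=
| T1 of lattice ns
| T2 of lattice ns & lattice ns.

Definition tarski_solution (k : nat) (ns : k.-tuple nat)
    (f : lattice ns -> lattice ns) (a : answer ns) : Prop :=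
  match a with
  | T1 x => f x = x
  | T2 x y => lattice_le x y /\ ~ lattice_le (f x) (f y)
  end.

(* The number of binary digits of [a], with [bitlen 0 = 1]. *)
Definition bitlen (a : nat) : nat := (trunc_log 2 a).+1.

(* A circuit with [m] inputs has wires [0 .. m-1] for the inputs; the gate at
   position [j] of [gates] drives wire [m + j] and may only read earlier
   wires. *)
Inductive gate : Type :=
| GConst of bool
| GNot of nat
| GAnd of nat & nat
| GOr of nat & nat.

Record circuit : Type := Circuit { gates : seq gate; outs : seq nat }.

Definition circuit_size (c : circuit) : nat := size (gates c).

Definition gate_wf (l : nat) (g : gate) : bool :=
  match g with
  | GConst _ => true
  | GNot a => a < l
  | GAnd a b | GOr a b => (a < l) && (b < l)
  end.

Definition circuit_wf (m r : nat) (c : circuit) : Prop :=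
  [/\ forall j, j < size (gates c) -> gate_wf (m + j) (nth (GConst false) (gates c) j),
      size (outs c) = r
    & all (fun a => a < m + size (gates c)) (outs c)].

Definition gate_eval (vals : seq bool) (g : gate) : bool :=
  match g with
  | GConst b => b
  | GNot a => ~~ nth false vals a
  | GAnd a b => nth false vals a && nth false vals b
  | GOr a b => nth false vals a || nth false vals b
  end.

Definition circuit_eval (c : circuit) (input : seq bool) : seq bool :=
  let vals := foldl (fun vs g => rcons vs (gate_eval vs g)) input (gates c) in
  [seq nth false vals a | a <- outs c].

(* Little-endian binary expansion on [w] bits. *)
Definition bits (w a : nat) : seq bool := mkseq (fun j => odd (a %/ 2 ^ j)) w.

Definition point_bits (w : nat) (x : seq nat) : seq bool :=
  flatten [seq bits w a | a <- x].

(* Every coordinate is written on as many bits as [n = side ns] needs. Nothing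
   is required of [c] on bit strings that do not encode a point of [L]. *)
Definition presents (k : nat) (ns : k.-tuple nat) (c : circuit)
    (f : lattice ns -> lattice ns) : Prop :=
  let w := bitlen (side ns) in
  circuit_wf (k * w) (k * w) c /\
  forall x : lattice ns,
    circuit_eval c (point_bits w (sval x)) = point_bits w (sval (f x)).

(* Algorithms are programs of a random-access machine under the logarithmic
   cost criterion: registers and memory cells hold natural numbers, and an
   elementary operation costs the total bit length of the numbers it handles,
   including the address for an indirect access. Subtraction is truncated;
   tests are tests for being nonzero. *)
Inductive prog : Type :=
| Skip
| Const (r c : nat)
| Add (r a b : nat)
| Sub (r a b : nat)
| Half (r a : nat)
| Read (r a : nat)
| Write (a b : nat)
| Seq (p q : prog)
| If (r : nat) (p q : prog)
| While (r : nat) (p : prog).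

Record state : Type := State { regs : nat -> nat; mem : nat -> nat }.

Definition upd (g : nat -> nat) (i v : nat) : nat -> nat :=
  fun j => if j == i then v else g j.

Definition set_reg (s : state) (r v : nat) : state :=
  State (upd (regs s) r v) (mem s).

Definition set_mem (s : state) (a v : nat) : state :=
  State (regs s) (upd (mem s) a v).

(* [exec p s s' t]: started in [s], [p] halts in [s'] after time [t]. *)
Inductive exec : prog -> state -> state -> nat -> Prop :=
| ESkip s : exec Skip s s 1
| EConst s r c : exec (Const r c) s (set_reg s r c) (bitlen c)
| EAdd s r a b :
    exec (Add r a b) s (set_reg s r (regs s a + regs s b))
         (bitlen (regs s a) + bitlen (regs s b))
| ESub s r a b :
    exec (Sub r a b) s (set_reg s r (regs s a - regs s b))
         (bitlen (regs s a) + bitlen (regs s b))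
| EHalf s r a :
    exec (Half r a) s (set_reg s r (regs s a)./2) (bitlen (regs s a))
| ERead s r a :
    exec (Read r a) s (set_reg s r (mem s (regs s a)))
         (bitlen (regs s a) + bitlen (mem s (regs s a)))
| EWrite s a b :
    exec (Write a b) s (set_mem s (regs s a) (regs s b))
         (bitlen (regs s a) + bitlen (regs s b))
| ESeq p q s1 s2 s3 t1 t2 :
    exec p s1 s2 t1 -> exec q s2 s3 t2 -> exec (Seq p q) s1 s3 (t1 + t2)
| EIfTrue r p q s s' t :
    regs s r != 0 -> exec p s s' t ->
    exec (If r p q) s s' (bitlen (regs s r) + t)
| EIfFalse r p q s s' t :
    regs s r = 0 -> exec q s s' t ->
    exec (If r p q) s s' (bitlen (regs s r) + t)
| EWhileStop r p s :
    regs s r = 0 -> exec (While r p) s s (bitlen (regs s r))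
| EWhileLoop r p s1 s2 s3 t1 t2 :
    regs s1 r != 0 -> exec p s1 s2 t1 -> exec (While r p) s2 s3 t2 ->
    exec (While r p) s1 s3 (bitlen (regs s1 r) + t1 + t2).

Lemma exec_det p s s1 t1 s2 t2 :
  exec p s s1 t1 -> exec p s s2 t2 -> s1 = s2 /\ t1 = t2.
Proof.
move=> H; elim: H s2 t2 => {p s s1 t1}; do ?[by intros; inversion H].
- move=> p q s1 s2 s3 t1 t2 _ IH1 _ IH2 s4 t4 H.
  inversion H as [| | | | | | |p' q' u1 u2 u3 v1 v2 E1 E2| | | |]; subst.
  by have [? ?] := IH1 _ _ E1; subst; have [? ?] := IH2 _ _ E2; subst.
- move=> r p q s s' t nz _ IH s2 t2 H.
  inversion H as [| | | | | | | |r' p' q' u u' v E1 E2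
                 |r' p' q' u u' v E1 E2| |]; subst; last by rewrite E1 in nz.
  by have [? ?] := IH _ _ E2; subst.
- move=> r p q s s' t z _ IH s2 t2 H.
  inversion H as [| | | | | | | |r' p' q' u u' v E1 E2
                 |r' p' q' u u' v E1 E2| |]; subst; first by rewrite z in E1.
  by have [? ?] := IH _ _ E2; subst.
- move=> r p s z s2 t2 H.
  inversion H as [| | | | | | | | | |r' p' u E1
                 |r' p' u1 u2 u3 v1 v2 E1 E2 E3]; subst => //.
  by rewrite z in E1.
- move=> r p s1 s2 s3 t1 t2 nz _ IH1 _ IH2 s4 t4 H.
  inversion H as [| | | | | | | | | |r' p' u E1
                 |r' p' u1 u2 u3 v1 v2 E1 E2 E3]; subst.
    by rewrite E1 in nz.
  by have [? ?] := IH1 _ _ E2; subst; have [? ?] := IH2 _ _ E3; subst.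
Qed.

Definition gate_code (g : gate) : seq nat :=
  match g with
  | GConst b => [:: 0; nat_of_bool b; 0]
  | GNot a => [:: 1; a; 0]
  | GAnd a b => [:: 2; a; b]
  | GOr a b => [:: 3; a; b]
  end.

(* The input is [k], [n_1 .. n_k], the number of gates, the gates (three cells
   each) and the output wires. *)
Definition instance_code (k : nat) (ns : k.-tuple nat) (c : circuit) : seq nat :=
  k :: ns ++ circuit_size c :: flatten [seq gate_code g | g <- gates c] ++ outs c.

Definition answer_code (k : nat) (ns : k.-tuple nat) (a : answer ns) : seq nat :=
  match a with
  | T1 x => 1 :: sval x
  | T2 x y => 2 :: sval x ++ sval y
  end.

Definition init_state (input : seq nat) : state :=
  State (fun _ => 0) (nth 0 input).

Definition holds_output (s : state) (output : seq nat) : Prop :=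
  forall i, i < size output -> mem s i = nth 0 output i.

Definition log2 (R : realType) (n : nat) : R := (ln n%:R / ln 2)%R.

Definition eval2 (R : realType) (p : {poly {poly R}}) (x y : R) : R :=
  (p.[x%:P].[y])%R.

(* Main.v *)
Require Import Defs.
From HB Require Import structures.
From mathcomp Require Import all_boot all_order all_algebra.
From mathcomp Require Import boolp reals sequences exp.
From mathcomp Require Import zify ring lra.
(* Imported again so that [Sub] is the machine instruction, not [eqtype.Sub]. *)
Require Import Defs.

(** Nested binary search, one level per coordinate, flattened into a single
loop. Level [c] keeps an interval [lo c, hi c] for coordinate [c], together with
two earlier query points that certify its ends. Each round evaluates the circuit
at the point [x] of midpoints and looks at the least [j] with [f x j <> x j]. If
there is none, [x] is a fixed point. Otherwise [x] is a certificate that shrinks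
the interval of level [j], and the levels below [j] restart between the
certificates of level [j]; when the interval of level [j] would become empty, [x]
and the opposite certificate violate monotonicity.

Writing [w] for the bit length of [n], there are at most [w ^ k] rounds. This is
[O (log n ^ k)] when [k < w], because [(1 + 1 / log n) ^ k <= e]. When [w <= k]
the query takes the lower ends instead of the midpoints: the search is then a
Kleene iteration from the bottom, of at most [k * n] rounds, and
[n < 2 ^ k <= 2 * log n ^ (k - 1)] as soon as [4 <= n]. *)

Set Implicit Arguments.
Unset Strict Implicit.
Unset Printing Implicit Defensive.

(** The search yields the exponent [k]; the surplus factor [log n] is absorbed by the polynomial, so
    no sharper method for low dimensions is called for. The delicate point is rounding: a level is
    charged a factor [w], not [log n], and for fixed [n] the loss [(1 + 1 / log n) ^ k] is
    exponential in [k], beyond any polynomial. Hence the second regime. Certificates are kept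
    because [f] is arbitrary: a slice of the lattice need not contain a fixed point of the
    restricted map, and an inner search that fails has to exhibit a violation at once. A certificate
    of level [j] stays comparable with every query made until it is replaced, so the second point of
    the violating pair is at hand without a record of all past queries. The machine has no call
    stack; the intervals and certificates are the whole state of the nested recursion. *)

(** * A program logic with a clock for the machine *)

Definition mach (e : seq nat) (m : nat -> nat) : state := State (nth 0 e) m.

Definition bounded (M : nat) (e : seq nat) (m : nat -> nat) : Prop :=
  all (fun v => v <= M) e /\ forall a, m a <= M.

(* Total correctness with a clock: started with [T] elementary steps already
   spent, [p] halts in a state and at a step count satisfying [Q], and no
   number handled on the way exceeds [M]. *)
Definition ok (M T : nat) (p : prog) (e : seq nat) (m : nat -> nat)
    (Q : nat -> seq nat -> (nat -> nat) -> Prop) : Prop :=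
  bounded M e m -> exists e' m' t n,
    [/\ exec p (mach e m) (mach e' m') t, t <= n * (2 * bitlen M),
        bounded M e' m' & Q (T + n) e' m'].

(** With the registers in a list, zero beyond its end, symbolic execution becomes computation on an
    explicit list. *)
Lemma set_reg_mach e m r v : set_reg (mach e m) r v = mach (set_nth 0 e r v) m.
Proof.
rewrite /set_reg /mach /=; congr State; apply: funext => i.
by rewrite /upd nth_set_nth.
Qed.

Lemma bitlen_mono a b : a <= b -> bitlen a <= bitlen b.
Proof. by move=> ab; rewrite /bitlen ltnS leq_trunc_log. Qed.

Lemma bounded_nth M e m r : bounded M e m -> nth 0 e r <= M.
Proof.
move=> [/allP h _]; have [lt|ge] := ltnP r (size e); last by rewrite nth_default.
by apply: h; rewrite mem_nth.
Qed.

Lemma bounded_set_nth M e m r v :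
  bounded M e m -> v <= M -> bounded M (set_nth 0 e r v) m.
Proof.
move=> B vM; split; last by case: B.
apply/(all_nthP 0) => i _; rewrite nth_set_nth /=.
by case: ifP => // _; apply: bounded_nth B.
Qed.

Lemma bounded_upd M e m a v : bounded M e m -> v <= M -> bounded M e (upd m a v).
Proof.
by move=> [h h'] vM; split=> // i; rewrite /upd; case: ifP.
Qed.

Section Rules.
Variable M : nat.
Implicit Types (T : nat) (p q : prog) (e : seq nat) (m : nat -> nat).
Implicit Types Q : nat -> seq nat -> (nat -> nat) -> Prop.

Lemma ok_weaken T p e m Q Q' :
  ok M T p e m Q -> (forall T' e' m', Q T' e' m' -> Q' T' e' m') ->
  ok M T p e m Q'.
Proof.
move=> h hQ B; have [e' [m' [t [n [E tn B' q]]]]] := h B.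
by exists e', m', t, n; split=> //; apply: hQ.
Qed.

Lemma ok_seq T p q e m Q :
  ok M T p e m (fun T' e' m' => ok M T' q e' m' Q) -> ok M T (Seq p q) e m Q.
Proof.
move=> h B; have [e1 [m1 [t1 [n1 [E1 tn1 B1 h1]]]]] := h B.
have [e2 [m2 [t2 [n2 [E2 tn2 B2 h2]]]]] := h1 B1.
exists e2, m2, (t1 + t2), (n1 + n2); split=> //; last by rewrite addnA.
  exact: ESeq E1 E2.
by rewrite mulnDl leq_add.
Qed.

(** One tick pays for one instruction: no instruction handles more than two numbers, and each has at
    most [bitlen M] digits. *)
Lemma ok_step T p e m Q e' m' t :
  exec p (mach e m) (mach e' m') t ->
  (bounded M e m -> t <= 2 * bitlen M /\ bounded M e' m') -> Q T.+1 e' m' ->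
  ok M T p e m Q.
Proof.
move=> E h q B; have [tb B'] := h B.
by exists e', m', t, 1; rewrite mul1n addn1.
Qed.

Lemma ok_skip T e m Q : Q T.+1 e m -> ok M T Skip e m Q.
Proof. by apply: ok_step; [exact: ESkip|move=> B; split=> //; rewrite muln_gt0]. Qed.

Lemma ok_const T r c e m Q :
  c <= M -> Q T.+1 (set_nth 0 e r c) m -> ok M T (Const r c) e m Q.
Proof.
move=> cM; apply: ok_step; first by rewrite -set_reg_mach; apply: EConst.
move=> B; split; last exact: bounded_set_nth.
by rewrite (leq_trans (bitlen_mono cM))// leq_pmull.
Qed.

Lemma bitlen2 a b : a <= M -> b <= M -> bitlen a + bitlen b <= 2 * bitlen M.
Proof. by move=> ? ?; rewrite mul2n -addnn leq_add// bitlen_mono. Qed.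

(** Apart from [Const], only this instruction can produce a value larger than all those present,
    hence the side condition. *)
Lemma ok_add T r a b e m Q :
  nth 0 e a + nth 0 e b <= M ->
  Q T.+1 (set_nth 0 e r (nth 0 e a + nth 0 e b)) m -> ok M T (Add r a b) e m Q.
Proof.
move=> cM; apply: ok_step; first by rewrite -set_reg_mach; apply: Defs.EAdd.
move=> B; split; last exact: bounded_set_nth.
by apply: bitlen2; apply: bounded_nth B.
Qed.

Lemma ok_sub T r a b e m Q :
  Q T.+1 (set_nth 0 e r (nth 0 e a - nth 0 e b)) m -> ok M T (Sub r a b) e m Q.
Proof.
apply: ok_step; first by rewrite -set_reg_mach; apply: Defs.ESub.
move=> B; have Ba := bounded_nth a B; have Bb := bounded_nth b B.
split; last by apply: bounded_set_nth => //; apply: leq_trans (leq_subr _ _) Ba.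
exact: bitlen2.
Qed.

Lemma ok_half T r a e m Q :
  Q T.+1 (set_nth 0 e r (nth 0 e a)./2) m -> ok M T (Half r a) e m Q.
Proof.
apply: ok_step; first by rewrite -set_reg_mach; apply: EHalf.
move=> B; have Ba := bounded_nth a B; split.
  by rewrite (leq_trans (bitlen_mono Ba))// leq_pmull.
by apply: bounded_set_nth => //; lia.
Qed.

Lemma ok_read T r a e m Q :
  Q T.+1 (set_nth 0 e r (m (nth 0 e a))) m -> ok M T (Read r a) e m Q.
Proof.
apply: ok_step; first by rewrite -set_reg_mach; apply: ERead.
move=> B; have Ba := bounded_nth a B; have Bm := B.2 (nth 0 e a).
by split; [apply: bitlen2|apply: bounded_set_nth].
Qed.

Lemma ok_write T a b e m Q :
  Q T.+1 e (upd m (nth 0 e a) (nth 0 e b)) -> ok M T (Write a b) e m Q.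
Proof.
apply: ok_step; first exact: EWrite.
move=> B; have Ba := bounded_nth a B; have Bb := bounded_nth b B.
by split; [apply: bitlen2|apply: bounded_upd].
Qed.

Lemma ok_if T r p q e m Q :
  (nth 0 e r != 0 -> ok M T.+1 p e m Q) -> (nth 0 e r = 0 -> ok M T.+1 q e m Q) ->
  ok M T (If r p q) e m Q.
Proof.
move=> hp hq B; have Br := bounded_nth r B.
have tb t n : t <= n * (2 * bitlen M) ->
    bitlen (nth 0 e r) + t <= n.+1 * (2 * bitlen M).
  by move=> tn; rewrite mulSn leq_add// (leq_trans (bitlen_mono Br))// leq_pmull.
have [z|nz] := eqVneq (nth 0 e r) 0.
- have [e' [m' [t [n [E tn B' H]]]]] := hq z B.
  exists e', m', (bitlen (nth 0 e r) + t), n.+1; split=> //; last by rewrite addnS.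
    exact: EIfFalse.
  exact: tb.
- have [e' [m' [t [n [E tn B' H]]]]] := hp nz B.
  exists e', m', (bitlen (nth 0 e r) + t), n.+1; split=> //; last by rewrite addnS.
    exact: EIfTrue.
  exact: tb.
Qed.

(** The clock is an argument of the invariant, so that a time bound can be carried as part of it;
    each test takes one tick. *)
Lemma ok_while (I : nat -> nat -> seq nat -> (nat -> nat) -> Prop) T v r p e m Q :
  I v T e m ->
  (forall v' T' e' m', I v' T' e' m' -> nth 0 e' r != 0 ->
     ok M T'.+1 p e' m' (fun T'' e'' m'' => exists2 v'', v'' < v' & I v'' T'' e'' m'')) ->
  (forall v' T' e' m', I v' T' e' m' -> nth 0 e' r = 0 -> Q T'.+1 e' m') ->
  ok M T (While r p) e m Q.
Proof.
move=> Iv hp hq; elim/ltn_ind: v T e m Iv => v IH T e m Iv B.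
have Br := bounded_nth r B.
have [z|nz] := eqVneq (nth 0 e r) 0.
  exists e, m, (bitlen (nth 0 e r)), 1; split=> //.
  - exact: EWhileStop.
  - by rewrite mul1n (leq_trans (bitlen_mono Br))// leq_pmull.
  - by rewrite addn1; apply: hq Iv z.
have [e1 [m1 [t1 [n1 [E1 tn1 B1 [v1 v1v I1]]]]]] := hp _ _ _ _ Iv nz B.
have [e2 [m2 [t2 [n2 [E2 tn2 B2 H2]]]]] := IH _ v1v _ _ _ I1 B1.
exists e2, m2, (bitlen (nth 0 e r) + t1 + t2), (n1 + n2).+1; split=> //.
- exact: EWhileLoop E1 E2.
- move: (bitlen_mono Br) tn1 tn2; set D := bitlen M; nia.
- by have <- : T.+1 + n1 + n2 = T + (n1 + n2).+1 by lia.
Qed.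

End Rules.

Ltac step :=
  lazymatch goal with
  | |- ok _ _ (Seq _ _) _ _ _ => apply: ok_seq
  | |- ok _ _ (Add _ _ _) _ _ _ => apply: ok_add; rewrite /=; first try lia
  | |- ok _ _ (Sub _ _ _) _ _ _ => apply: ok_sub; rewrite /=
  | |- ok _ _ (Half _ _) _ _ _ => apply: ok_half; rewrite /=
  | |- ok _ _ (Read _ _) _ _ _ => apply: ok_read; rewrite /=
  | |- ok _ _ (Write _ _) _ _ _ => apply: ok_write; rewrite /=
  | |- ok _ _ (Const _ _) _ _ _ => apply: ok_const; rewrite /=; first try lia
  | |- ok _ _ Skip _ _ _ => apply: ok_skip; rewrite /=
  end.

(** * Registers and block copies *)

Notation "p ;; q" := (Seq p q) (at level 60, right associativity).

(* Registers up to [rRun] keep their value throughout the main loop, those from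
   [rSrc] on belong to [copy], the others are scratch. *)
Notation rZ := 0 (only parsing).
Notation rOne := 1 (only parsing).
Notation rK := 2 (only parsing).
Notation rW := 3 (only parsing).
Notation rG := 4 (only parsing).
Notation rGp := 5 (only parsing).
Notation rV := 6 (only parsing).
Notation rX := 7 (only parsing).
Notation rLo := 8 (only parsing).
Notation rHi := 9 (only parsing).
Notation rEnd := 10 (only parsing).
Notation rK2 := 11 (only parsing).
Notation rFlag := 12 (only parsing).
Notation rRun := 13 (only parsing).
Notation rA := 14 (only parsing).
Notation rB := 15 (only parsing).
Notation rP := 16 (only parsing).
Notation rQ := 17 (only parsing).
Notation rR := 18 (only parsing).
Notation rS := 19 (only parsing).
Notation rT := 20 (only parsing).
Notation rU := 21 (only parsing).
Notation rY := 22 (only parsing).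
Notation rJ := 23 (only parsing).
Notation rRow := 24 (only parsing).
Notation rUp := 25 (only parsing).
Notation rXj := 26 (only parsing).
Notation rFound := 27 (only parsing).
Notation rSrc := 28 (only parsing).
Notation rDst := 29 (only parsing).
Notation rLen := 30 (only parsing).
Notation rTmp := 31 (only parsing).

Notation incr r := (Add r r rOne).
Notation decr r := (Sub r r rOne).
Notation mov r a := (Add r a rZ).

Definition copy : prog :=
  While rLen (Read rTmp rSrc ;; Write rDst rTmp ;; incr rSrc ;; incr rDst ;; decr rLen).

Definition blit (dst src len : nat) (m : nat -> nat) : nat -> nat :=
  fun a => if dst <= a < dst + len then m (src + (a - dst)) else m a.

Ltac case_ifs := repeat (case: ifP; let h := fresh "h" in intro h; try (exfalso; lia)).

Lemma blit0 dst src m : blit dst src 0 m = m.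
Proof. by apply: funext => a; rewrite /blit; case: ifP => //; lia. Qed.

Lemma blitS dst src len m : (dst + len.+1 <= src) || (src + len.+1 <= dst) ->
  blit dst.+1 src.+1 len (upd m dst (m src)) = blit dst src len.+1 m.
Proof.
move=> h; apply: funext => a; rewrite /blit /upd.
by case_ifs; try (congr m; lia).
Qed.

Ltac seq32 e :=
  do 32 (let z := fresh "z" in destruct e as [|z e]; [by []|]);
  destruct e as [|? ?]; [|by []].

(** A cell costs five instructions and a test, and one more test ends the loop. Only the last four
    registers change, and [rDst] is left just past the copied block. *)
Lemma ok_copy M T e m Q src dst len :
  size e = 32 -> nth 0 e rOne = 1 ->
  nth 0 e rSrc = src -> nth 0 e rDst = dst -> nth 0 e rLen = len ->
  src + len <= M -> dst + len <= M ->
  (dst + len <= src) || (src + len <= dst) ->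
  (forall z, Q (T + 6 * len).+1 (take 28 e ++ [:: src + len; dst + len; 0; z])
               (blit dst src len m)) ->
  ok M T copy e m Q.
Proof.
move=> sz e1 es ed el sM dM dj HQ.
pose I v T' e' m' := exists s d z,
  [/\ T' + 6 * v = T + 6 * len, e' = take 28 e ++ [:: s; d; v; z],
     s + v = src + len, d + v = dst + len
   & v <= len /\ blit d s v m' = blit dst src len m].
apply: (ok_while (I := I) (v := len)) => //.
- exists src, dst, (nth 0 e 31); split=> //.
  by rewrite -es -ed -el; seq32 e.
- move=> v' T' e' m' [s [d [z [hT -> hs hd [hv hm]]]]].
  have {}dj : (d + v' <= s) || (s + v' <= d) by lia.
  rewrite /I; seq32 e; move: e1; rewrite /= => -> v0.
  do 9 step.
  exists v'.-1; first by lia.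
  exists (s + 1), (d + 1), (m' s); split; try lia.
    by rewrite subn1.
  split; first by lia.
  case: v' v0 {hT hs hd hv} hm dj => // v' _ hm dj.
  by rewrite !addn1 /= blitS.
- move=> v' T' e' m' [s [d [z [hT -> hs hd [_ hm]]]]].
  have -> : nth 0 (take 28 e ++ [:: s; d; v'; z]) 30 = v' by seq32 e.
  move=> v0; move: hT hs hd hm; rewrite v0 !addn0 blit0 => -> -> -> ->.
  exact: HQ.
Qed.

(** * The search in the abstract: certificates, invariant and measure *)

Section Search.
Variables (k : nat) (F : (nat -> nat) -> nat -> nat).

(* For [R := leq], [A c] certifies the lower end [lo c]: any point [z] the search
   may still query at level [c] satisfies [A c <= z], so [lo c <= F (A c) c] and
   monotonicity give [lo c <= F z c]; [cert_below] lets the lower levels restart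
   from [A c] itself. [R := geq] handles the upper ends. *)
Record certified (R : rel nat) (x lo : nat -> nat) (A : nat -> nat -> nat) : Prop :=
  Certified {
    cert_lo : forall c i, i <= c < k -> R (A c i) (lo i);
    cert_x : forall c i, c < i < k -> R (A c i) (x i);
    cert_nested : forall c c' i, i < c -> c <= c' < k -> R (A c' i) (A c i);
    cert_bound : forall c, c < k -> R (lo c) (F (A c) c);
    cert_below : forall c i, i < c < k -> R (A c i) (F (A c) i);
    cert_query : forall c, c < k -> R (lo c) (x c) }.

Definition newrow (j : nat) (a : nat -> nat) (A : nat -> nat -> nat) c :=
  if c <= j then a else A c.

Definition newbound (j : nat) (a : nat -> nat) (l : nat) (lo : nat -> nat) c :=
  if c < j then a c else if c == j then l else lo c.

(** Serves both sides of both moves. On the side that shrinks, [a] is the query and [l] the value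
    next to [x j]; on the other side, [a] is the present certificate of level [j] and [l] its
    unchanged end. Levels below [j] restart at [a] itself, which the last condition on [F a] makes
    legitimate. *)
Lemma certified_update R x x' lo A j a l :
  reflexive R -> transitive R -> certified R x lo A -> j < k ->
  (forall c i, i < j -> j <= c < k -> R (A c i) (a i)) ->
  R (lo j) l -> R (a j) l -> (forall i, j < i < k -> R (a i) (x i)) ->
  R l (F a j) -> (forall i, i < j -> R (a i) (F a i)) ->
  (forall i, j < i < k -> x' i = x i) ->
  (forall c, c < k -> R (newbound j a l lo c) (x' c)) ->
  certified R x' (newbound j a l lo) (newrow j a A).
Proof.
move=> Rr Rt [h1 h2 h3 h4 h5 h6] jk C1 C2 C3 C4 C5 C6 xx h6'.
rewrite /newrow; split=> //.
- move=> c i ic; rewrite /newbound; case: (leqP c j) => cj; case: (ltngtP i j) => ij; try lia.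
  + exact: Rr.
  + by rewrite ij.
  + by apply: C1; lia.
  + by apply: h1; lia.
  + by rewrite ij; apply: Rt C2; apply: h1; lia.
- move=> c i ci; case: (leqP c j) => cj; last by rewrite xx; [apply: h2; lia|lia].
  have := h6' i; rewrite /newbound; case: (ltngtP i j) => ij h; last 1 first.
  + by rewrite ij; apply: Rt C3 _; rewrite -ij; apply: h; lia.
  + by apply: h; lia.
  + by rewrite xx ?C4//; lia.
- move=> c c' i ic cc; case: (leqP c' j) => c'j; case: (leqP c j) => cj; try lia.
  + exact: Rr.
  + by apply: C1; lia.
  + by apply: h3; lia.
- move=> c ck; rewrite /newbound; case: (ltngtP c j) => cj.
  + exact: C6.
  + exact: h4.
  + by rewrite cj.
- move=> c i ic; case: (leqP c j) => cj; first by apply: C6; lia.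
  by apply: h5; lia.
Qed.

Variables (fl n w : nat) (ns : nat -> nat).
Hypothesis nsn : forall i, i < k -> ns i <= n.

Definition point (x : nat -> nat) := forall i, i < k -> 1 <= x i <= ns i.
Hypothesis pointF : forall x, point x -> point (F x).

Definition mid (l h : nat) : nat := if fl != 0 then l else (l + h)./2.

Definition query (lo hi : nat -> nat) c := mid (lo c) (hi c).

Record search_inv (lo hi : nat -> nat) (A B : nat -> nat -> nat) : Prop := Inv {
  inv_lo : certified leq (query lo hi) lo A;
  inv_hi : certified geq (query lo hi) hi B;
  inv_le : forall c, c < k -> lo c <= hi c;
  inv_A : forall c, c < k -> point (A c);
  inv_B : forall c, c < k -> point (B c) }.

Lemma mid_between l h : l <= h -> l <= mid l h <= h.
Proof. by rewrite /mid; case: eqP => /= _; lia. Qed.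

Lemma inv_point lo hi A B : search_inv lo hi A B -> point (query lo hi).
Proof.
move=> [iA iB le pA pB] i ik; have := mid_between (le i ik); rewrite /query.
have := cert_lo iA (c := i) (i := i); have := cert_lo iB (c := i) (i := i).
have := pA i ik i ik; have := pB i ik i ik; rewrite /=; lia.
Qed.

(** The query is fixed below [j] and pushed up at [j], so every later point above it must have [F]
    at least [(x j).+1] in coordinate [j], unless monotonicity fails. This makes [x] a lower
    certificate for [j] and for all levels below. *)
Lemma inv_up lo hi A B j (x := query lo hi) : search_inv lo hi A B -> j < k ->
  (forall i, i < j -> F x i = x i) -> x j < F x j -> x j < hi j ->
  search_inv (newbound j x (x j).+1 lo) (newbound j (B j) (hi j) hi)
      (newrow j x A) (newrow j (B j) B).
Proof.
move=> I jk Fx up xh; have px := inv_point I; case: (I) => iA iB le pA pB.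
have lx c : c < k -> lo c <= x c <= hi c by move=> ck; apply: mid_between; apply: le.
set lo' := newbound _ _ _ lo; set hi' := newbound _ _ _ hi.
have le' c : c < k -> lo' c <= hi' c.
  move=> ck; rewrite /lo' /hi' /newbound; case: (ltngtP c j) => cj.
  (* The restarted interval runs from [x c] to [B j c]; it is nonempty because
     [x c <= hi c <= B j c]. *)
  - have := cert_lo iB (c := j) (i := c); have := lx c ck; rewrite /=; lia.
  - exact: le.
  - by rewrite ?cj; lia.
have xx i : j < i < k -> query lo' hi' i = x i.
  by move=> h; rewrite /query /lo' /hi' /newbound !ifN//; lia.
split=> //.
- apply: (certified_update (x := x)) => //; try lia.
  + exact: leq_trans.
  + move=> c i ij jc; have := cert_lo iA (c := c) (i := i).
    by have := lx i; lia.
  + by have := lx j jk; lia.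
  + by move=> i ij; rewrite Fx.
  + by move=> c ck; have /andP[] := mid_between (le' c ck).
- have tr : transitive geq by move=> a b c /= ab bc; lia.
  apply: (certified_update (x := x)) => //.
  + exact: leqnn.
  + by move=> c i ij jc; apply: (cert_nested iB); lia.
  + exact: leqnn.
  + by have := cert_lo iB (c := j) (i := j); rewrite /=; lia.
  + by move=> i ij; apply: (cert_x iB).
  + exact: (cert_bound iB).
  + by move=> i ij; apply: (cert_below iB); lia.
  + by move=> c ck; have /andP[] := mid_between (le' c ck).
- by move=> c ck; rewrite /newrow; case: ifP => // _; apply: pA.
- by move=> c ck; rewrite /newrow; case: ifP => // _; apply: pB.
Qed.

Lemma inv_down lo hi A B j (x := query lo hi) : search_inv lo hi A B -> j < k ->
  (forall i, i < j -> F x i = x i) -> F x j < x j -> lo j < x j ->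
  search_inv (newbound j (A j) (lo j) lo) (newbound j x (x j).-1 hi)
      (newrow j (A j) A) (newrow j x B).
Proof.
move=> I jk Fx up xh; have px := inv_point I; case: (I) => iA iB le pA pB.
have lx c : c < k -> lo c <= x c <= hi c by move=> ck; apply: mid_between; apply: le.
set lo' := newbound _ _ _ lo; set hi' := newbound _ _ _ hi.
have le' c : c < k -> lo' c <= hi' c.
  move=> ck; rewrite /lo' /hi' /newbound; case: (ltngtP c j) => cj.
  - have := cert_lo iA (c := j) (i := c); have := lx c ck; rewrite /=; lia.
  - exact: le.
  - by rewrite ?cj; lia.
have xx i : j < i < k -> query lo' hi' i = x i.
  by move=> h; rewrite /query /lo' /hi' /newbound !ifN//; lia.
have tr : transitive geq by move=> a b c /= ab bc; lia.
split=> //.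
- apply: (certified_update (x := x)) => //.
  + exact: leq_trans.
  + by move=> c i ij jc; apply: (cert_nested iA); lia.
  + by have := cert_lo iA (c := j) (i := j); rewrite /=; lia.
  + by move=> i ij; apply: (cert_x iA).
  + exact: (cert_bound iA).
  + by move=> i ij; apply: (cert_below iA); lia.
  + by move=> c ck; have /andP[] := mid_between (le' c ck).
- apply: (certified_update (x := x)) => //=; try lia.
  + exact: leqnn.
  + move=> c i ij jc; have := cert_lo iB (c := c) (i := i).
    by have := lx i; rewrite /=; lia.
  + by have := lx j jk; lia.
  + by move=> i ij; rewrite Fx.
  + by move=> c ck; have /andP[] := mid_between (le' c ck).
- by move=> c ck; rewrite /newrow; case: ifP => // _; apply: pA.
- by move=> c ck; rewrite /newrow; case: ifP => // _; apply: pB.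
Qed.

(** Here [F (B j) j <= hi j <= x j < F x j]. Moreover [x] lies below [B j]: through [hi] in the
    coordinates up to [j], through [cert_x] in the others. *)
Lemma violation_up lo hi A B j (x := query lo hi) : search_inv lo hi A B -> j < k ->
  x j < F x j -> hi j <= x j ->
  (forall i, i < k -> x i <= B j i) /\ F (B j) j < F x j.
Proof.
move=> I jk up xh; case: (I) => iA iB le pA pB.
have lx c : c < k -> lo c <= x c <= hi c by move=> ck; apply: mid_between; apply: le.
split; last by have := cert_bound iB jk; rewrite /=; lia.
move=> i ik; case: (leqP i j) => ij.
  by have := cert_lo iB (c := j) (i := i); have := lx i ik; rewrite /=; lia.
by apply: (cert_x iB); lia.
Qed.

Lemma violation_down lo hi A B j (x := query lo hi) : search_inv lo hi A B -> j < k ->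
  F x j < x j -> x j <= lo j ->
  (forall i, i < k -> A j i <= x i) /\ F x j < F (A j) j.
Proof.
move=> I jk up xh; case: (I) => iA iB le pA pB.
have lx c : c < k -> lo c <= x c <= hi c by move=> ck; apply: mid_between; apply: le.
split; last by have := cert_bound iA jk; rewrite /=; lia.
move=> i ik; case: (leqP i j) => ij.
  by have := cert_lo iA (c := j) (i := i); have := lx i ik; rewrite /=; lia.
by apply: (cert_x iA); lia.
Qed.

(** [F] does not leave the lattice, so its bottom and top certify the ends of all levels at once. *)
Lemma inv_init a b : (forall i, i < k -> a i = 1) -> (forall i, i < k -> b i = ns i) ->
  (forall i, i < k -> 0 < ns i) ->
  search_inv a b (fun _ => a) (fun _ => b).
Proof.
move=> a1 bn ns0.
have pa : point a by move=> i ik; rewrite a1// ns0.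
have pb : point b by move=> i ik; rewrite bn//; have := ns0 i ik; lia.
have ab c : c < k -> a c <= b c by move=> ck; rewrite a1// bn// ns0.
have lx c : c < k -> a c <= query a b c <= b c.
  by move=> ck; apply: mid_between; apply: ab.
have Fa := pointF pa; have Fb := pointF pb.
split=> //; split=> //=.
- by move=> c i ci; have := lx i; lia.
- by move=> c ck; rewrite a1//; have := Fa c ck; lia.
- by move=> c i ci; have := Fa i; rewrite a1; lia.
- by move=> c ck; have := lx c ck; lia.
- by move=> c i ci; have := lx i; lia.
- by move=> c ck; rewrite bn//; have := Fb c ck; lia.
- by move=> c i ci; have := Fb i; rewrite bn; lia.
- by move=> c ck; have := lx c ck; lia.
Qed.

Lemma sum_lt (f g : nat -> nat) j K : (forall c, c < K -> f c <= g c) -> j < K ->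
  f j < g j -> \sum_(c < K) f c < \sum_(c < K) g c.
Proof.
elim: K => // K IH fg; rewrite !big_ord_recr /= ltnS leq_eqVlt => /orP[/eqP->|jK] lt.
  rewrite -addnS; apply: leq_add lt; apply: leq_sum => i _; apply: fg.
  by have := ltn_ord i; lia.
rewrite -addSn; apply: leq_add; last exact: fg.
by apply: IH => // c ck; apply: fg; apply: ltnW.
Qed.

Lemma radix_small (f : nat -> nat) K W : 0 < W -> (forall c, c < K -> f c < W) ->
  \sum_(c < K) f c * W ^ c < W ^ K.
Proof.
move=> W0; elim: K => [|K IH] fW; first by rewrite big_ord0.
rewrite big_ord_recr /= expnS; have := IH (fun c ck => fW c (ltnW ck)).
have := fW K (leqnn _); set S := \sum_(_ < _) _; set P := W ^ K; nia.
Qed.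

(** A drop of digit [j] outweighs whatever happens to the lower digits, as long as the new ones are
    genuine digits in base [W]. *)
Lemma radix_lt (f g : nat -> nat) j K W : 0 < W -> j < K ->
  (forall c, j < c < K -> f c = g c) -> f j < g j ->
  (forall c, c < j -> f c < W) ->
  \sum_(c < K) f c * W ^ c < \sum_(c < K) g c * W ^ c.
Proof.
move=> W0; elim: K => // K IH; rewrite ltnS leq_eqVlt => /orP[/eqP<-|jK] fg lt fW.
  rewrite !big_ord_recr /=; have := radix_small W0 fW.
  set S := \sum_(_ < _) _; set S' := \sum_(_ < _) _; set P := W ^ _; nia.
rewrite !big_ord_recr /= fg ?ltn_add2r; last by rewrite jK /=.
by apply: IH => // c cK; apply: fg; lia.
Qed.

(* With midpoints a level survives at most [trunc_log 2] of its width many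
   halvings, and restarting the levels below it costs one digit in base [w]. *)
Definition meas (lo hi : nat -> nat) : nat :=
  if fl != 0 then \sum_(c < k) (n - lo c)
  else \sum_(c < k) trunc_log 2 (hi c - lo c).+1 * w ^ c.

Lemma inv_range lo hi A B c : search_inv lo hi A B -> c < k -> 1 <= lo c /\ hi c <= n.
Proof.
move=> [iA iB _ pA pB] ck.
have := cert_lo iA (c := c) (i := c); have := cert_lo iB (c := c) (i := c).
by have := pA c ck c ck; have := pB c ck c ck; have := nsn ck; rewrite /=; lia.
Qed.

Hypothesis wn : w = bitlen n.

Lemma log_width l h : 1 <= l -> h <= n -> trunc_log 2 (h - l).+1 < w.
Proof.
move=> l1 hn; rewrite wn /bitlen ltnS.
case: (posnP n) => n0; last by apply: leq_trunc_log; lia.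
by have -> : h - l = 0 by lia; rewrite trunc_log1.
Qed.

(** [s] and [s'] count the points of an interval. Removing the midpoint and one side leaves at most
    half of them, rounded down. *)
Lemma log_halve s s' : 0 < s' -> s' <= s./2 -> trunc_log 2 s' < trunc_log 2 s.
Proof.
move=> s0 h; rewrite (@trunc_log2S s); last by lia.
by rewrite ltnS leq_trunc_log.
Qed.

(** In Kleene mode the query is [lo], so the restart leaves the lower ends below [j] where they were
    and only [lo j] grows; the upper ends may widen, but the sum does not see them. *)
Lemma meas_up lo hi A B j (x := query lo hi)
    (lo' := newbound j x (x j).+1 lo) (hi' := newbound j (B j) (hi j) hi) :
  search_inv lo hi A B -> search_inv lo' hi' (newrow j x A) (newrow j (B j) B) -> j < k ->
  x j < hi j -> meas lo' hi' < meas lo hi.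
Proof.
move=> I I' jk xh; rewrite /meas; case: eqP => /= [fl0|/eqP fl0].
  apply: (radix_lt (j := j) (f := fun c => trunc_log 2 (hi' c - lo' c).+1)
    (g := fun c => trunc_log 2 (hi c - lo c).+1)) => //.
  - by rewrite wn.
  - by move=> c cj; rewrite /lo' /hi' /newbound !ifN//; lia.
  - rewrite /lo' /hi' /newbound ltnn eqxx; apply: log_halve; first by lia.
    by move: xh (inv_le I jk); rewrite /x /query /mid fl0 /=; lia.
  - move=> c cj; have ck : c < k by lia.
    by have [? ?] := inv_range I' ck; apply: log_width.
have xlo i : x i = lo i by rewrite /x /query /mid fl0.
apply: (sum_lt (j := j) (f := fun c => n - lo' c) (g := fun c => n - lo c)) => //.
- move=> c ck; rewrite /lo' /newbound !xlo.
  by case: (ltngtP c j) => cj //; rewrite ?cj; lia.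
- rewrite /lo' /newbound ltnn eqxx xlo.
  by have [? ?] := inv_range I jk; move: xh; rewrite xlo; lia.
Qed.

(** Kleene mode never makes this move: its query sits at the lower ends, against [lo j < x j], so a
    downward step is already a violation. *)
Lemma meas_down lo hi A B j (x := query lo hi)
    (lo' := newbound j (A j) (lo j) lo) (hi' := newbound j x (x j).-1 hi) :
  search_inv lo hi A B -> search_inv lo' hi' (newrow j (A j) A) (newrow j x B) -> j < k ->
  lo j < x j -> meas lo' hi' < meas lo hi.
Proof.
move=> I I' jk xh; rewrite /meas; case: eqP => /= [fl0|/eqP fl0]; last first.
  by move: xh; rewrite /x /query /mid fl0 ltnn.
apply: (radix_lt (j := j) (f := fun c => trunc_log 2 (hi' c - lo' c).+1)
    (g := fun c => trunc_log 2 (hi c - lo c).+1)) => //.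
- by rewrite wn.
- by move=> c cj; rewrite /lo' /hi' /newbound !ifN//; lia.
- rewrite /lo' /hi' /newbound ltnn eqxx; apply: log_halve; first by lia.
  by move: xh (inv_le I jk); rewrite /x /query /mid fl0 /=; lia.
- move=> c cj; have ck : c < k by lia.
  by have [? ?] := inv_range I' ck; apply: log_width.
Qed.

Lemma meas_le lo hi A B : search_inv lo hi A B ->
  meas lo hi <= if fl != 0 then k * n else w ^ k.
Proof.
move=> I; rewrite /meas; case: ifP => _.
  rewrite -[X in _ <= X * _]card_ord -sum_nat_const; apply: leq_sum => i _; lia.
apply: ltnW; apply: (@radix_small (fun c => trunc_log 2 (hi c - lo c).+1)); first by rewrite wn.
by move=> c ck; have [? ?] := inv_range I ck; apply: log_width.
Qed.

End Search.

(** * The program *)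

(** Each row is copied from the row just above it, so the certificates of the starting level spread
    downwards; the new ends of level [c] are the entries [c] of its two certificates. Started at the
    sentinel level, the same code initialises every level. *)
Definition descend : prog :=
  While rA (
    mov rSrc rR ;; Sub rR rR rK2 ;; mov rDst rR ;; mov rLen rK2 ;; copy ;;
    decr rA ;;
    Add rT rR rA ;; Read rY rT ;; Add rU rLo rA ;; Write rU rY ;;
    Add rT rT rK ;; Read rY rT ;; Add rU rHi rA ;; Write rU rY).

Definition emit_bits : prog :=
  While rB (
    Half rU rT ;; Add rY rU rU ;; Sub rY rT rY ;; Write rS rY ;; incr rS ;;
    mov rT rU ;; decr rB).

(** When [rFlag] is set the upper end is overwritten by the lower one, and the common averaging code
    then returns the lower end. *)
Definition build_query : prog :=
  mov rA rK ;; mov rP rX ;; mov rQ rLo ;; mov rR rHi ;; mov rS rV ;;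
  While rA (
    Read rT rQ ;; Read rU rR ;; If rFlag (mov rU rT) Skip ;;
    Add rT rT rU ;; Half rT rT ;; Write rP rT ;;
    mov rB rW ;; emit_bits ;;
    incr rP ;; incr rQ ;; incr rR ;; decr rA).

(** The opcode is decoded by counting it down to zero. A conjunction or disjunction keeps the second
    operand unless the first one decides the value. *)
Definition eval_gates : prog :=
  mov rA rG ;; mov rP rGp ;;
  While rA (
    Read rT rP ;; incr rP ;; Read rU rP ;; incr rP ;; Read rY rP ;; incr rP ;;
    If rT (
      decr rT ;; Add rU rV rU ;; Read rU rU ;;
      If rT (
        decr rT ;; Add rY rV rY ;; Read rY rY ;;
        If rT (If rU (mov rY rOne) Skip) (If rU Skip (mov rY rZ)))
      (Sub rY rOne rU))
    (mov rY rU) ;;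
    Write rS rY ;; incr rS ;; decr rA).

(** Output bits are little-endian, so they are read backwards and the value is built by Horner's
    rule. *)
Definition read_value : prog :=
  While rB (
    decr rQ ;; Read rT rQ ;; Add rT rV rT ;; Read rT rT ;;
    Add rY rY rY ;; Add rY rY rT ;; decr rB).

(** Coordinates are scanned downwards and each difference overwrites the recorded one, which leaves
    the least index. The distance is the sum of the two truncated differences; [rUp] keeps one of
    them, nonzero exactly for a move up. *)
Definition compare : prog :=
  mov rA rK ;; mov rQ rV ;; mov rP rLo ;; mov rR rEnd ;; mov rFound rZ ;;
  While rA (
    decr rA ;; decr rP ;; Sub rR rR rK2 ;;
    mov rY rZ ;; mov rB rW ;; read_value ;;
    Read rT rP ;; Sub rU rY rT ;; Sub rY rT rY ;; Add rY rY rU ;;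
    If rY (mov rJ rA ;; mov rRow rR ;; mov rUp rU ;; mov rXj rT ;; mov rFound rOne)
       Skip).

Definition emit_point : prog :=
  Write rZ rOne ;; mov rSrc rX ;; mov rDst rOne ;; mov rLen rK ;; copy ;;
  Const rRun 0.

(** The second copy continues at the address where the first one left [rDst]. *)
Definition emit_pair : prog :=
  Const rT 2 ;; Write rZ rT ;;
  mov rSrc rP ;; mov rDst rOne ;; mov rLen rK ;; copy ;;
  mov rSrc rQ ;; mov rLen rK ;; copy ;; Const rRun 0.

Definition move_up : prog :=
  Add rT rHi rJ ;; Read rT rT ;; Sub rT rT rXj ;;
  If rT (
    mov rSrc rX ;; mov rDst rRow ;; mov rLen rK ;; copy ;;
    Add rT rLo rJ ;; incr rXj ;; Write rT rXj ;;
    mov rA rJ ;; mov rR rRow ;; descend)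
  (mov rP rX ;; Add rQ rRow rK ;; emit_pair).

Definition move_down : prog :=
  Add rT rLo rJ ;; Read rT rT ;; Sub rT rXj rT ;;
  If rT (
    mov rSrc rX ;; Add rDst rRow rK ;; mov rLen rK ;; copy ;;
    Add rT rHi rJ ;; decr rXj ;; Write rT rXj ;;
    mov rA rJ ;; mov rR rRow ;; descend)
  (mov rP rRow ;; mov rQ rX ;; emit_pair).

Definition body : prog :=
  build_query ;; eval_gates ;; compare ;;
  If rFound (If rUp move_up move_down) emit_point.

(** A running maximum is [s + (t - s)] with truncated subtraction, the bit length is the number of
    halvings down to zero, and the product [k * w] is a repeated addition. *)
Definition measure_instance : prog :=
  Const rOne 1 ;; Read rK rZ ;; mov rA rK ;;
  While rA (incr rP ;; Read rT rP ;; Sub rU rT rS ;; Add rS rS rU ;; decr rA) ;;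
  While rS (Half rS rS ;; incr rW) ;;
  mov rA rK ;; While rA (Add rB rB rW ;; decr rA).

(** [rP] holds [k.+1], the address of the gate count, so the final subtraction gives a flag that is
    nonzero exactly when [w <= k]. *)
Definition layout : prog :=
  Add rP rK rOne ;; Read rG rP ;; Add rGp rP rOne ;;
  Add rV rGp rG ;; Add rV rV rG ;; Add rV rV rG ;; Add rV rV rB ;;
  Add rX rV rB ;; Add rX rX rG ;; Add rLo rX rK ;; Add rHi rLo rK ;;
  Add rEnd rHi rK ;; Add rK2 rK rK ;;
  mov rA rK ;; While rA (Add rEnd rEnd rK2 ;; decr rA) ;;
  Sub rFlag rP rW.

Definition first_rows : prog :=
  mov rA rK ;; mov rDst rEnd ;;
  While rA (Write rDst rOne ;; incr rDst ;; decr rA) ;;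
  mov rSrc rOne ;; mov rLen rK ;; copy ;;
  Const rRun 1 ;; mov rA rK ;; mov rR rEnd ;; descend.

Definition tarski_prog : prog :=
  measure_instance ;; layout ;; first_rows ;; While rRun body.

(** * Memory layout, restarting levels and writing the query *)

(* Memory: the input below [V], the wires at [V], the query point at [X], the
   interval ends at [LO] and [HI], and for each level [c <= k] the certificates of
   both ends, [k] cells each, at [row_addr c]. Level [k] is a sentinel holding the
   bottom and the top of the lattice. [fl] is nonzero iff [w <= k], which selects
   Kleene iteration. *)
Section Machine.
Variables (M k w g fl mm gp V X LO HI k2 : nat) (inp : nat -> nat).
Hypothesis mmE : mm = k * w.
Hypothesis gpE : gp = k.+2.
Hypothesis VE : V = gp + 3 * g + mm.
Hypothesis XE : X = V + mm + g.
Hypothesis LOE : LO = X + k.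
Hypothesis HIE : HI = LO + k.
Hypothesis k2E : k2 = k + k.
Definition row_addr (c : nat) := HI + k + c * k2.
Definition End := row_addr k.
Hypothesis EndM : row_addr k + k2 <= M.
Hypothesis powM : 2 ^ w.+1 <= M.

Lemma rowS c : row_addr c.+1 = row_addr c + k2.
Proof. by rewrite /row_addr mulSn; lia. Qed.

Lemma row_lt c c' : c < c' -> row_addr c + k2 <= row_addr c'.
Proof. by rewrite /row_addr => cc'; nia. Qed.

Lemma row_le c c' : c <= c' -> row_addr c <= row_addr c'.
Proof. by rewrite /row_addr => cc'; nia. Qed.

Lemma row_ge c : HI + k <= row_addr c.
Proof. by rewrite /row_addr; lia. Qed.

Lemma row_sep c c' i : c != c' -> i < k2 -> ~~ (row_addr c' <= row_addr c + i < row_addr c' + k2).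
Proof.
rewrite neq_ltn => /orP[] /row_lt; lia.
Qed.

Definition pers run := [:: 0; 1; k; w; g; gp; V; X; LO; HI; End; k2; fl; run].

Definition frame run (e : seq nat) := size e = 32 /\ take 14 e = pers run.

(* The levels [v <= c < j] have been reset to the certificates of level [j]. *)
Definition descended (v j : nat) (m m' : nat -> nat) : Prop :=
  [/\ forall a, a < LO -> m' a = m a,
      forall c, c < k -> m' (LO + c) = if v <= c < j then m (row_addr j + c) else m (LO + c),
      forall c, c < k -> m' (HI + c) = if v <= c < j then m (row_addr j + k + c) else m (HI + c)
    & forall c i, c <= k -> i < k2 ->
        m' (row_addr c + i) = if v <= c < j then m (row_addr j + i) else m (row_addr c + i)].

Lemma blit_out dst src len m a : ~~ (dst <= a < dst + len) -> blit dst src len m a = m a.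
Proof. by rewrite /blit => /negbTE->. Qed.

Lemma blit_in dst src len m i : i < len -> blit dst src len m (dst + i) = m (src + i).
Proof. by move=> h; rewrite /blit ifT; [congr m|]; lia. Qed.

Lemma upd_out m a v b : b != a -> upd m a v b = m b.
Proof. by rewrite /upd => /negbTE->. Qed.

Lemma upd_in m a v : upd m a v a = v.
Proof. by rewrite /upd eqxx. Qed.

Lemma descended_step v j m m' : v < j -> j <= k -> descended v.+1 j m m' ->
  let m1 := blit (row_addr v) (row_addr v.+1) k2 m' in
  let m2 := upd m1 (LO + v) (m1 (row_addr v + v)) in
  descended v j m (upd m2 (HI + v) (m2 (row_addr v + v + k))).
Proof.
move=> vj jk [h1 h2 h3 h4] m1 m2.
have rg := row_ge v.
have r1 i : i < k2 -> m1 (row_addr v + i) = m (row_addr j + i).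
  move=> ik; rewrite /m1 blit_in// h4//; last by lia.
  (* The row above [v] carries the certificates of [j] either because it was reset already or
     because it is row [j] itself. *)
  case: ifP => // h; have -> : v.+1 = j by lia.
  by [].
have r2 : m2 (row_addr v + v + k) = m (row_addr j + k + v).
  rewrite /m2 upd_out; last by lia.
  by rewrite -addnA r1; [congr m; lia|lia].
have r0 a : a < HI + k -> m1 a = m' a.
  by move=> h; rewrite /m1 blit_out//; lia.
rewrite r2 {r2}; split.
- move=> a aL; rewrite /m2 !upd_out; [|lia|lia].
  by rewrite r0 ?h1//; lia.
- move=> c ck; rewrite upd_out; last by lia.
  have [->|cv] := eqVneq c v.
    by rewrite /m2 upd_in r1 ?ifT//; lia.
  rewrite /m2 upd_out; last by lia.
  rewrite r0 ?h2//; last by lia.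
  by congr (if _ then _ else _); lia.
- move=> c ck; have [->|cv] := eqVneq c v.
    by rewrite upd_in ?ifT//; lia.
  rewrite /m2 !upd_out; [|lia|lia].
  rewrite r0 ?h3//; last by lia.
  by congr (if _ then _ else _); lia.
- move=> c i ck ik; have := row_ge c => rc.
  rewrite /m2 !upd_out; [|lia|lia].
  have [->|cv] := eqVneq c v; first by rewrite r1 ?ifT//; lia.
  rewrite /m1 blit_out; last exact: row_sep.
  by rewrite h4//; congr (if _ then _ else _); lia.
Qed.

Ltac open_frame e :=
  let h1 := fresh in let h2 := fresh in
  intros [h1 h2]; seq32 e; move: h2; rewrite /pers;
  case=> -> -> -> -> -> -> -> -> -> -> -> -> -> ->.

Lemma ok_descend T run e m j Q : j <= k -> frame run e ->
  nth 0 e rA = j -> nth 0 e rR = row_addr j ->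
  (forall T' e' m', T' <= T + j * (6 * k2 + 20) + 1 -> frame run e' ->
     descended 0 j m m' -> Q T' e' m') ->
  ok M T descend e m Q.
Proof.
move=> jk fe ea er HQ.
pose I v T' e' m' := [/\ v <= j, T' + v * (6 * k2 + 20) <= T + j * (6 * k2 + 20),
  frame run e' /\ nth 0 e' rA = v, nth 0 e' rR = row_addr v & descended v j m m'].
apply: (ok_while (I := I) (v := j)).
- split=> //; split=> // [c|c|c i] *; by rewrite ifN//; lia.
- move=> v T' e' m' [vj hT [fe' ea'] er' d]; rewrite ea'.
  case: v => // v in vj hT ea' er' d * => _.
  have r1 := row_lt vj; have r2 := rowS v; have r3 := row_le jk; have r4 := row_ge v.
  have r5 : row_addr v.+1 <= row_addr k by apply: row_le; lia.
  move: fe' ea' er'; open_frame e'; rewrite /= => -> ->.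
  do 9 step.
  apply: (@ok_copy _ _ _ _ _ (row_addr v.+1) (row_addr v) k2); rewrite //=; try lia.
  move=> tmp; do 17 step.
  exists v => //.
  have -> : row_addr v.+1 - k2 = row_addr v by lia.
  rewrite subn1 /=; split=> //; try lia.
  exact: descended_step.
- move=> v T' e' m' [vj hT [fe' ea'] er' d]; rewrite ea' => v0.
  by rewrite v0 in hT d; apply: HQ => //; lia.
Qed.

Definition bits_at (m : nat -> nat) (a x w' : nat) : Prop :=
  forall b, b < w' -> m (a + b) = odd (x %/ 2 ^ b).

Lemma ok_emit_bits T run e m x a Q : frame run e ->
  nth 0 e rB = w -> nth 0 e rT = x -> nth 0 e rS = a -> a + w <= M -> x <= M ->
  (forall T' m' z1 z2 z3, T' <= T + w * 8 + 1 ->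
     (forall b, (b < a) || (a + w <= b) -> m' b = m b) -> bits_at m' a x w ->
     Q T' (take 15 e ++ [:: 0] ++ take 3 (drop 16 e) ++ [:: a + w; z1; z2; z3] ++ drop 23 e) m') ->
  ok M T emit_bits e m Q.
Proof.
move=> fe eb et es aM xM HQ.
pose I v T' e' m' := exists z2 z3,
  [/\ v <= w, T' + v * 8 <= T + w * 8,
   e' = take 15 e ++ [:: v] ++ take 3 (drop 16 e) ++
        [:: a + (w - v); x %/ 2 ^ (w - v); z2; z3] ++ drop 23 e,
   (forall b, (b < a) || (a + w <= b) -> m' b = m b) & bits_at m' a x (w - v)].
apply: (ok_while (I := I) (v := w)).
- exists (nth 0 e 21), (nth 0 e 22); split=> //.
  + rewrite subnn expn0 divn1 addn0 -eb -et -es.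
    by case: fe => h _; seq32 e.
  + by move=> b; rewrite subnn.
- move=> v T' e' m' [z2 [z3 [vw hT -> hm hb]]] {HQ eb et es}.
  case: v vw hT hb => [|v] vw hT hb; first by case: fe => h _; seq32 e.
  move=> _; rewrite /I; move: fe; open_frame e; rewrite /=.
  set y := x %/ 2 ^ (w - v.+1).
  have yx : y <= x by apply: leq_div.
  do 13 step.
  exists v => //; exists (y./2), (y - (y./2 + y./2)).
  have wv : w - v = (w - v.+1).+1 by lia.
  rewrite subn1 wv /=; split=> //; try lia.
  + by rewrite -addnA addn1 addn0 expnSr divnMA -/y divn2.
  + by move=> b hbb; rewrite upd_out ?hm//; lia.
  + move=> b; rewrite ltnS leq_eqVlt => /orP[/eqP->|lt].
      by rewrite upd_in -/y; have := odd_double_half y; rewrite -addnn; lia.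
    by rewrite upd_out ?hb//; lia.
- move=> v T' e' m' [z2 [z3 [vw hT -> hm hb]]].
  set e1 := take 15 e ++ _; have -> : nth 0 e1 15 = v.
    by rewrite /e1; case: fe => h _; seq32 e.
  move=> v0; rewrite {}/e1 v0 subn0 in hT hb *.
  by apply: HQ => //; lia.
Qed.

Definition rep (lo hi : nat -> nat) (A B : nat -> nat -> nat) (m : nat -> nat) : Prop :=
  [/\ forall a, a < V -> m a = inp a,
      forall c, c < k -> m (LO + c) = lo c,
      forall c, c < k -> m (HI + c) = hi c,
      forall c i, c < k -> i < k -> m (row_addr c + i) = A c i
    & forall c i, c < k -> i < k -> m (row_addr c + k + i) = B c i].

(** The wires and the query point fill the cells from [V] up to [LO]; evaluating the circuit may
    write only there. *)
Definition outside (m m' : nat -> nat) : Prop :=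
  forall a, (a < V) || (LO <= a) -> m' a = m a.

Lemma rep_outside lo hi A B m m' : outside m m' -> rep lo hi A B m -> rep lo hi A B m'.
Proof.
move=> o [h1 h2 h3 h4 h5]; split.
- by move=> a aV; rewrite o ?h1//; lia.
- by move=> c ck; rewrite o ?h2//; lia.
- by move=> c ck; rewrite o ?h3//; lia.
- by move=> c i ck ik; have := row_ge c => rc; rewrite o ?h4//; lia.
- by move=> c i ck ik; have := row_ge c => rc; rewrite o ?h5//; lia.
Qed.

Definition queried (x : nat -> nat) (u : nat) (m : nat -> nat) : Prop :=
  (forall c, c < u -> m (X + c) = x c) /\
  (forall c, c < u -> bits_at m (V + c * w) (x c) w).

Lemma ok_build_query T run e m lo hi A B Q : frame run e -> rep lo hi A B m ->
  (forall c, c < k -> lo c + hi c <= M) -> (forall c, c < k -> lo c <= hi c) ->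
  (forall T' e' m', T' <= T + k * (8 * w + 20) + 10 -> frame run e' ->
     nth 0 e' rS = V + mm -> outside m m' -> queried (query fl lo hi) k m' ->
     Q T' e' m') ->
  ok M T build_query e m Q.
Proof.
move=> fe re lohi loh HQ; have rk := row_ge k.
move: (fe); open_frame e; rewrite /=.
rewrite /build_query; do 10 step.
pose I v T' e' m' := [/\ v <= k, T' + v * (8 * w + 20) <= T + 9 + k * (8 * w + 20),
  frame run e' /\ nth 0 e' rA = v,
  [/\ nth 0 e' rP = X + (k - v), nth 0 e' rQ = LO + (k - v), nth 0 e' rR = HI + (k - v)
   & nth 0 e' rS = V + (k - v) * w] &
  outside m m' /\ queried (query fl lo hi) (k - v) m'].
apply: (ok_while (I := I) (v := k)).
- have uu : k - k = 0 by lia.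
  rewrite /I uu /= mul0n !addn0; split=> //; lia.
- move=> v T' e' m' [vk hT [fe' ea'] [ep eq er es] [o q]]; rewrite ea'.
  case: v => // v in vk hT ea' ep eq er es q * => _.
  have kv : k - v = (k - v.+1).+1 by lia.
  set u := k - v.+1 in ep eq er es q kv *.
  have uk : u < k by lia.
  have mu : u * w + w <= mm by rewrite mmE -mulSnr leq_mul.
  have lohu := lohi u uk; have lou := loh u uk.
  case: (rep_outside o re) => r1 r2 r3 r4 r5.
  move: fe' ea' ep eq er es; open_frame e'; rewrite /= => -> -> -> -> ->.
  do 4 step; rewrite r2// r3//.
  (* Both branches meet in one postcondition: [rU] holds some [y], either end, whose average with
     [lo u] is the query coordinate. *)
  step; match goal with |- ok _ _ _ ?E _ _ =>
    apply: (ok_weaken (Q := fun T'' e'' m'' => [/\ T'' <= T'.+1 + 4, m'' = m' & exists y,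
      [/\ y + lo u <= M, (lo u + y)./2 = query fl lo hi u & e'' = set_nth 0 E rU y]])) end.
    apply: ok_if => /= f0; step; split=> //; try lia.
    + exists (lo u + 0); split=> //; first by lia.
      by rewrite /query /mid f0; lia.
    + exists (hi u); split=> //; first by lia.
      by rewrite /query /mid f0.
  move=> T1 e1 m1 [hT1 -> [y [yM qE ->]]]; rewrite /=.
  do 9 step; rewrite qE.
  apply: (ok_emit_bits (run := run) (x := query fl lo hi u) (a := V + u * w)) => //=; try lia.
  move=> T2 m2 y1 y2 y3 hT2 h2 hb.
  do 7 step; exists v => //; rewrite /I kv subn1 /=.
  split=> //; try lia.
  + by split=> //=; lia.
  + split.
      move=> a ha; rewrite h2; last by lia.
      by rewrite upd_out ?o//; lia.
    case: q => q1 q2; split=> c; rewrite ltnS leq_eqVlt => /orP[/eqP->|lt].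
    * by rewrite h2 ?upd_in//; lia.
    * rewrite h2; last by lia.
      by rewrite upd_out ?q1//; lia.
    * exact: hb.
    * move=> b bw; have : c * w + w <= u * w by rewrite -mulSnr leq_mul.
      move=> cu; rewrite h2; last by lia.
      by rewrite upd_out; [apply: q2|lia].
- move=> v T' e' m' [vk hT [fe' ea'] [ep eq er es] [o q]]; rewrite ea' => v0.
  rewrite v0 subn0 in hT es q; apply: HQ => //; first by lia.
  by rewrite es mmE.
Qed.


(** * Evaluating the circuit and comparing its value with the query *)

Variables (gs : seq gate) (os : seq nat).
Hypothesis gs_size : size gs = g.
Hypothesis gs_wf : forall j, j < g -> gate_wf (mm + j) (nth (GConst false) gs j).
Hypothesis gs_code : forall i b, i < g -> b < 3 ->
  inp (gp + 3 * i + b) = nth 0 (gate_code (nth (GConst false) gs i)) b.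
Hypothesis os_wf : forall i, i < mm -> nth 0 os i < mm + g.
Hypothesis os_code : forall i, i < mm -> inp (gp + 3 * g + i) = nth 0 os i.

Section Gates.
Variable v0 : seq bool.
Hypothesis v0_size : size v0 = mm.

Definition wires u :=
  foldl (fun vs g => rcons vs (gate_eval vs g)) v0 (take u gs).

Lemma wiresS u : u < g ->
  wires u.+1 = rcons (wires u) (gate_eval (wires u) (nth (GConst false) gs u)).
Proof.
by move=> ug; rewrite /wires (take_nth (GConst false)) ?gs_size// foldl_rcons.
Qed.

Lemma size_wires u : u <= g -> size (wires u) = mm + u.
Proof.
elim: u => [|u IH] ug; first by rewrite /wires take0 /= v0_size addn0.
by rewrite wiresS// size_rcons IH ?addnS//; lia.
Qed.

Definition wired u (m : nat -> nat) := forall i, i < mm + u -> m (V + i) = nth false (wires u) i.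

Lemma wired_step u m : u < g -> wired u m ->
  wired u.+1 (upd m (V + (mm + u)) (gate_eval (wires u) (nth (GConst false) gs u))).
Proof.
move=> ug h i iu; rewrite wiresS// nth_rcons size_wires; last by lia.
case: (ltngtP i (mm + u)) => iu'.
- by rewrite upd_out ?h//; lia.
- by lia.
- by rewrite iu' upd_in.
Qed.

Definition below_X (m m' : nat -> nat) : Prop :=
  forall a, (a < V) || (X <= a) -> m' a = m a.

Lemma ok_eval_gates T run e m Q : frame run e -> nth 0 e rS = V + mm ->
  (forall a, a < V -> m a = inp a) -> wired 0 m -> 3 <= M ->
  (forall T' e' m', T' <= T + g * 25 + 10 -> frame run e' -> below_X m m' ->
     wired g m' -> Q T' e' m') ->
  ok M T eval_gates e m Q.
Proof.
move=> fe es re w0 M3 HQ; have rk := row_ge k.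
move: (fe) es; open_frame e; rewrite /= => ->.
rewrite /eval_gates; do 4 step.
pose I v T' e' m' := [/\ v <= g, T' + v * 25 <= T + 9 + g * 25,
  frame run e' /\ nth 0 e' rA = v,
  nth 0 e' rP = gp + 3 * (g - v) /\ nth 0 e' rS = V + (mm + (g - v)) &
  below_X m m' /\ wired (g - v) m'].
apply: (ok_while (I := I) (v := g)).
- have uu : g - g = 0 by lia.
  by rewrite /I uu /= muln0 !addn0; split=> //; lia.
- move=> v T' e' m' [vk hT [fe' ea'] [ep es] [o q]]; rewrite ea'.
  case: v => // v in vk hT ea' ep es q * => _.
  have kv : g - v = (g - v.+1).+1 by lia.
  set u := g - v.+1 in ep es q kv *.
  have uk : u < g by lia.
  move: fe' ea' ep es; open_frame e'; rewrite /= => -> -> ->.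
  have re' a : a < V -> m' a = inp a by move=> aV; rewrite o ?re// aV.
  have wf := gs_wf uk; have code b := @gs_code u b uk.
  set gt := nth _ gs u in wf code *.
  have c0 : m' (gp + 3 * u) = nth 0 (gate_code gt) 0.
    by rewrite re' -?code ?addn0//; lia.
  have c1 : m' (gp + 3 * u + 1) = nth 0 (gate_code gt) 1.
    by rewrite re' -?code//; lia.
  have c2 : m' (gp + 3 * u + 1 + 1) = nth 0 (gate_code gt) 2.
    by rewrite re' -?code -?addnA//; lia.
  do 12 step; rewrite c0 c1 c2.
  (* All four gate types meet in one postcondition: [rY] holds the value of the gate, and [t'], [u']
     are whatever the branch left in scratch registers. *)
  step; match goal with |- ok _ _ _ ?E _ _ =>
    apply: (ok_weaken (Q := fun T'' e'' m'' => [/\ T'' <= T'.+1 + 18, m'' = m' &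
      exists t' u',
      e'' = set_nth 0 (set_nth 0 (set_nth 0 E rT t') rU u') rY (gate_eval (wires u) gt)])) end.
    have bM (b : bool) : b <= M by case: b; lia.
    case: (gt) wf => [b|a|a b|a b] /= wf.
    + apply: ok_if => //= _; step; split=> //; first by lia.
      by exists 0, b; rewrite addn0.
    + apply: ok_if => //= _; do 6 step; rewrite q//.
      apply: ok_if => //= _; step; split=> //; first by lia.
      by exists 0, (nth false (wires u) a); rewrite subnn; case: nth.
    + case/andP: wf => wa wb.
      apply: ok_if => //= _; do 6 step; rewrite q//.
      apply: ok_if => //= _; do 6 step; rewrite q//.
      apply: ok_if => //= _.
      apply: ok_if => /= ha; step; split=> //; try lia; exists 0, (nth false (wires u) a).
        by case: nth ha.
      by case: nth ha.
    + case/andP: wf => wa wb.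
      apply: ok_if => //= _; do 6 step; rewrite q//.
      apply: ok_if => //= _; do 6 step; rewrite q//.
      apply: ok_if => //= _.
      apply: ok_if => /= ha; step; split=> //; try lia; exists 1, (nth false (wires u) a).
        by case: nth ha.
      by case: nth ha.
  move=> T1 e1 m1 [hT1 -> [t' [u' ->]]]; rewrite /=.
  do 5 step; exists v => //; rewrite /I kv subn1 /=.
  split=> //; try lia.
  split; last exact: wired_step.
  by move=> a ha; rewrite upd_out ?o//; lia.
- move=> v T' e' m' [vk hT [fe' ea'] [ep es] [o q]]; rewrite ea' => v0'.
  rewrite v0' subn0 in hT q; apply: HQ => //; lia.
Qed.

End Gates.

Definition decodes (y : nat -> nat) (m : nat -> nat) := forall c b, c < k -> b < w ->
  m (V + nth 0 os (c * w + b)) = odd (y c %/ 2 ^ b).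

(** Once the bits from [v] upwards are read, [rY] holds [y c %/ 2 ^ v]. This is [0] at the start
    because [y c < 2 ^ w]. *)
Lemma ok_read_value T run e m y c Q : frame run e -> c < k ->
  nth 0 e rB = w -> nth 0 e rY = 0 -> nth 0 e rQ = gp + 3 * g + (c * w + w) ->
  (forall a, a < V -> m a = inp a) -> y c < 2 ^ w -> decodes y m ->
  (forall z, Q (T + w * 8).+1 (take 15 e ++ [:: 0; nth 0 e rP; gp + 3 * g + c * w;
      nth 0 e rR; nth 0 e rS; z; nth 0 e rU; y c] ++ drop 23 e) m) ->
  ok M T read_value e m Q.
Proof.
move=> fe ck eb ey eq re yw dm HQ; have rk := row_ge k.
have cw : c * w + w <= mm by rewrite mmE -mulSnr leq_mul.
pose I v T' e' m' := exists z,
  [/\ v <= w, T' + v * 8 = T + w * 8, m' = m &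
   e' = take 15 e ++ [:: v; nth 0 e rP; gp + 3 * g + (c * w + v);
      nth 0 e rR; nth 0 e rS; z; nth 0 e rU; y c %/ 2 ^ v] ++ drop 23 e].
apply: (ok_while (I := I) (v := w)).
- exists (nth 0 e 20); split=> //.
  rewrite divn_small//; move: eb ey eq {HQ fe yw}(proj1 fe); clear I.
  by move=> eb ey eq h; move: eb ey eq; seq32 e; rewrite /= => -> -> ->.
- move=> v T' e' m' [z' [vw hT -> ->]] {HQ eb ey eq}.
  case: v vw hT => [|v] vw hT; first by case: fe => h _; seq32 e.
  move=> _; rewrite /I; move: fe; open_frame e; rewrite /=.
  do 4 step.
  have -> : gp + 3 * g + (c * w + v.+1) - 1 = gp + 3 * g + (c * w + v) by lia.
  rewrite re; last by lia.
  rewrite os_code; last by lia.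
  have ob : nth 0 os (c * w + v) < mm + g by apply: os_wf; lia.
  do 4 step; rewrite dm//.
  have yd : y c %/ 2 ^ v.+1 + y c %/ 2 ^ v.+1 + odd (y c %/ 2 ^ v) = y c %/ 2 ^ v.
    have := odd_double_half (y c %/ 2 ^ v); rewrite -addnn -divn2 -divnMA -expnSr; lia.
  have yl : y c %/ 2 ^ v <= y c by apply: leq_div.
  have p2 : 2 ^ w <= 2 ^ w.+1 by rewrite leq_exp2l.
  do 5 step; rewrite yd.
  exists v => //; exists (odd (y c %/ 2 ^ v)); split=> //; try lia.
  by rewrite subn1.
- move=> v T' e' m' [z' [vw hT -> ->]] h.
  have v0' : v = 0 by move: h; case: fe => h' _; seq32 e.
  by rewrite v0' expn0 divn1 addn0 in hT *; have -> : T' = T + w * 8 by lia.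
Qed.

Definition first_diff (x y : nat -> nat) (v : nat) (e : seq nat) : Prop :=
  (nth 0 e rFound = 0 /\ forall c, v <= c < k -> y c = x c) \/
  exists j, [/\ nth 0 e rFound = 1, v <= j < k,
    nth 0 e rJ = j /\ nth 0 e rRow = row_addr j,
    nth 0 e rUp = y j - x j /\ nth 0 e rXj = x j &
    (forall i, v <= i < j -> y i = x i) /\ y j != x j].

Lemma ok_compare T run e m x y Q : frame run e ->
  (forall a, a < V -> m a = inp a) -> (forall c, c < k -> m (X + c) = x c) ->
  (forall c, c < k -> x c < 2 ^ w) -> (forall c, c < k -> y c < 2 ^ w) ->
  decodes y m ->
  (forall T' e', T' <= T + k * (8 * w + 30) + 12 -> frame run e' ->
     first_diff x y 0 e' -> Q T' e' m) ->
  ok M T compare e m Q.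
Proof.
move=> fe re mx xw yw dm HQ; have rk := row_ge k.
have p2 : 2 ^ w <= 2 ^ w.+1 by rewrite leq_exp2l.
move: (fe); open_frame e; rewrite /=.
have eM : End <= M by rewrite /End; lia.
have wM : w < 2 ^ w by rewrite ltn_expl.
rewrite /compare; do 10 step; rewrite ?addn0.
pose I v T' e' m' := [/\ v <= k, T' + v * (8 * w + 30) <= T + 11 + k * (8 * w + 30),
  frame run e' /\ nth 0 e' rA = v,
  [/\ nth 0 e' rP = X + v, nth 0 e' rR = row_addr v & nth 0 e' rQ = gp + 3 * g + v * w] &
  m' = m /\ first_diff x y v e'].
apply: (ok_while (I := I) (v := k)).
- rewrite /I; split=> //; try lia.
  + by split; rewrite //= -?mmE; lia.
  + by split=> //; left; split=> // c; lia.
- move=> v T' e' m' [vk hT [fe' ea'] [ep er eq] [-> fd]]; rewrite ea'.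
  case: v => // v in vk hT ea' ep er eq fd * => _.
  have xv := xw v vk; have yv := yw v vk.
  have r5 : row_addr v.+1 <= row_addr k by apply: row_le.
  have r2 := rowS v.
  move: (fe') ea' ep er eq; open_frame e'; rewrite /= => ea' ep er eq.
  rewrite {}ea' {}ep {}er {}eq in fd *.
  do 11 step; rewrite ?addn0.
  apply: (ok_read_value (run := run) (y := y) (c := v)) => //=; try lia.
  move=> tmp; do 2 step.
  have -> : X + v.+1 - 1 = X + v by lia.
  rewrite mx//; do 6 step.
  have -> : row_addr v.+1 - k2 = row_addr v by lia.
  rewrite subn1 /=.
  have hT2 : T'.+1 + 12 + w * 8 + 11 + v * (8 * w + 30) <= T + 11 + k * (8 * w + 30) by lia.
  apply: ok_if => /= d0.
    do 9 step; exists v => //; rewrite /I /= !addn0.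
    split=> //; try lia.
    split=> //; right; exists v; rewrite /=; split=> //; try lia.
    by split; [move=> i; lia|lia].
  step; exists v => //; rewrite /I /=.
  split=> //; try lia.
  split=> //; case: fd => /= [[f0 h]|[j [f1 jk h1 h2 [h3 h4]]]].
    left; split=> // c ck; have [->|cv] := eqVneq c v; first by lia.
    by apply: h; lia.
  right; exists j; split=> //; first by lia.
  split=> // i iv; have [->|cv] := eqVneq i v; first by lia.
  by apply: h3; lia.
- move=> v T' e' m' [vk hT [fe' ea'] [ep er eq] [-> fd]]; rewrite ea' => v0'.
  by rewrite v0' in hT fd; apply: HQ => //; lia.
Qed.

(** * Writing the answer, and the two moves in memory *)

Definition holds_point (x : nat -> nat) (m : nat -> nat) :=
  m 0 = 1 /\ forall i, i < k -> m i.+1 = x i.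

Definition holds_pair (x y : nat -> nat) (m : nat -> nat) :=
  [/\ m 0 = 2, forall i, i < k -> m i.+1 = x i & forall i, i < k -> m (k + i).+1 = y i].

Hypothesis w_gt0 : 0 < w.

(** A pair of points is written to the cells up to [k + k]; the points copied there lie at [X] or
    beyond and are not overwritten. *)
Lemma X_ge : k + k < X.
Proof. by have : k <= mm; [rewrite mmE leq_pmulr|lia]. Qed.

Lemma ok_emit_point T e m Q : frame 1 e ->
  (forall T' e' m', T' <= T + 6 * k + 10 -> frame 0 e' ->
     holds_point (fun i => m (X + i)) m' -> Q T' e' m') ->
  ok M T emit_point e m Q.
Proof.
move=> fe HQ; have rk := row_ge k; have Xk := X_ge.
move: (fe); open_frame e; rewrite /emit_point.
do 9 step; apply: (@ok_copy _ _ _ _ _ X 1 k); rewrite //=; try lia.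
move=> tmp; step; apply: HQ => //; first by lia.
split; first by rewrite blit_out// upd_in.
by move=> i ik; rewrite -add1n blit_in// upd_out//; lia.
Qed.

Lemma ok_emit_pair T e m p q Q : frame 1 e -> nth 0 e rP = p -> nth 0 e rQ = q ->
  k + k < p -> k + k < q -> p + k <= M -> q + k <= M -> 2 <= M ->
  (forall T' e' m', T' <= T + 12 * k + 20 -> frame 0 e' ->
     holds_pair (fun i => m (p + i)) (fun i => m (q + i)) m' -> Q T' e' m') ->
  ok M T emit_pair e m Q.
Proof.
move=> fe ep eq pk qk pM qM M2 HQ; have rk := row_ge k; have Xk := X_ge.
move: (fe) ep eq; open_frame e; rewrite /emit_pair /= => -> ->.
do 11 step; apply: (@ok_copy _ _ _ _ _ p 1 k); rewrite //=; try lia.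
move=> tmp; do 5 step.
apply: (@ok_copy _ _ _ _ _ q (1 + k) k); rewrite //=; try lia.
move=> tmp'; step; apply: HQ => //; first by lia.
split.
- by rewrite !blit_out ?upd_in//; lia.
- move=> i ik; rewrite blit_out; last by lia.
  by rewrite -add1n blit_in// upd_out//; lia.
- move=> i ik; have -> : (k + i).+1 = 1 + k + i by lia.
  by rewrite blit_in// blit_out ?upd_out//; lia.
Qed.

(** Only row [j] and [lo j] are written by the move itself; [descend] supplies the rest of [newrow]
    and [newbound]. *)
Lemma rep_up lo hi A B m m' j x : j < k -> rep lo hi A B m ->
  (forall c, c < k -> m (X + c) = x c) ->
  descended 0 j (upd (blit (row_addr j) X k m) (LO + j) (x j).+1) m' ->
  rep (newbound j x (x j).+1 lo) (newbound j (B j) (hi j) hi)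
      (newrow j x A) (newrow j (B j) B) m'.
Proof.
move=> jk [r1 r2 r3 r4 r5] mx [d1 d2 d3 d4].
have rj := row_ge j.
set m1 := upd _ _ _ in d1 d2 d3 d4.
have mL c : c < k -> m1 (LO + c) = if c == j then (x j).+1 else lo c.
  move=> ck; rewrite /m1; case: eqP => [->|ne]; first by rewrite upd_in.
  by rewrite upd_out ?blit_out ?r2//; lia.
have mH c : c < k -> m1 (HI + c) = hi c.
  by move=> ck; rewrite /m1 upd_out ?blit_out ?r3//; lia.
have mA c i : c < k -> i < k -> m1 (row_addr c + i) = if c == j then x i else A c i.
  move=> ck ik; have := row_ge c => rc; rewrite /m1 upd_out; last by lia.
  case: eqP => [->|/eqP ne]; first by rewrite blit_in ?mx.
  by rewrite blit_out ?r4//; have := row_sep (i := i) ne; lia.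
have mB c i : c < k -> i < k -> m1 (row_addr c + k + i) = B c i.
  move=> ck ik; have := row_ge c => rc; rewrite /m1 upd_out; last by lia.
  rewrite blit_out ?r5//; have [->|ne] := eqVneq c j; first by lia.
  by have := row_sep (i := k + i) ne; lia.
split.
- by move=> a aV; rewrite d1 /m1 ?upd_out ?blit_out ?r1//; lia.
- move=> c ck; rewrite d2// leq0n /= /newbound.
  by case: ltnP => cj; rewrite ?mL ?mA ?eqxx//; lia.
- move=> c ck; rewrite d3// leq0n /= /newbound.
  by case: (ltngtP c j) => cj; rewrite ?mH ?mB ?cj//; lia.
- move=> c i ck ik; rewrite d4 ?leq0n /=; [|lia|lia]; rewrite /newrow.
  by case: (ltngtP c j) => cj; rewrite ?mA ?cj ?eqxx ?ifN//; lia.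
- move=> c i ck ik; rewrite -addnA d4 ?leq0n /=; [|lia|lia]; rewrite !addnA /newrow.
  by case: (ltngtP c j) => cj; rewrite ?mB ?cj//; lia.
Qed.

Lemma rep_down lo hi A B m m' j x : j < k -> rep lo hi A B m ->
  (forall c, c < k -> m (X + c) = x c) ->
  descended 0 j (upd (blit (row_addr j + k) X k m) (HI + j) (x j).-1) m' ->
  rep (newbound j (A j) (lo j) lo) (newbound j x (x j).-1 hi)
      (newrow j (A j) A) (newrow j x B) m'.
Proof.
move=> jk [r1 r2 r3 r4 r5] mx [d1 d2 d3 d4].
have rj := row_ge j.
set m1 := upd _ _ _ in d1 d2 d3 d4.
have mH c : c < k -> m1 (HI + c) = if c == j then (x j).-1 else hi c.
  move=> ck; rewrite /m1; case: eqP => [->|ne]; first by rewrite upd_in.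
  by rewrite upd_out ?blit_out ?r3//; lia.
have mL c : c < k -> m1 (LO + c) = lo c.
  by move=> ck; rewrite /m1 upd_out ?blit_out ?r2//; lia.
have mB c i : c < k -> i < k -> m1 (row_addr c + k + i) = if c == j then x i else B c i.
  move=> ck ik; have := row_ge c => rc; rewrite /m1 upd_out; last by lia.
  case: eqP => [->|/eqP ne]; first by rewrite blit_in ?mx.
  by rewrite blit_out ?r5//; have := row_sep (i := k + i) ne; lia.
have mA c i : c < k -> i < k -> m1 (row_addr c + i) = A c i.
  move=> ck ik; have := row_ge c => rc; rewrite /m1 upd_out; last by lia.
  rewrite blit_out ?r4//; have [->|ne] := eqVneq c j; first by lia.
  by have := row_sep (i := i) ne; lia.
split.
- by move=> a aV; rewrite d1 /m1 ?upd_out ?blit_out ?r1//; lia.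
- move=> c ck; rewrite d2// leq0n /= /newbound.
  by case: (ltngtP c j) => cj; rewrite ?mL ?mA ?cj//; lia.
- move=> c ck; rewrite d3// leq0n /= /newbound.
  by case: ltnP => cj; rewrite ?mH ?mB ?eqxx//; lia.
- move=> c i ck ik; rewrite d4 ?leq0n /=; [|lia|lia]; rewrite /newrow.
  by case: (ltngtP c j) => cj; rewrite ?mA ?cj//; lia.
- move=> c i ck ik; rewrite -addnA d4 ?leq0n /=; [|lia|lia]; rewrite !addnA /newrow.
  by case: (ltngtP c j) => cj; rewrite ?mB ?cj ?eqxx ?ifN//; lia.
Qed.

(** * One round and the main loop *)

Variables (n : nat) (ns : nat -> nat) (F : (nat -> nat) -> nat -> nat).
Hypothesis nsn : forall i, i < k -> ns i <= n.
Hypothesis pointF : forall x, point k ns x -> point k ns (F x).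
Hypothesis wn : w = bitlen n.
Hypothesis circF : forall x, point k ns x -> forall c b, c < k -> b < w ->
  nth false (wires (point_bits w (mkseq x k)) g) (nth 0 os (c * w + b))
  = odd (F x c %/ 2 ^ b).
Hypothesis M3 : 3 <= M.

Lemma n_lt : n < 2 ^ w.
Proof. by rewrite wn /bitlen; apply: trunc_log_ltn. Qed.

Lemma size_point_bits x : size (point_bits w x) = size x * w.
Proof.
elim: x => //= a x IH; rewrite /point_bits /= size_cat -/(point_bits w x) IH.
by rewrite /bits size_mkseq mulSn.
Qed.

Lemma nth_point_bits x c b : c < size x -> b < w ->
  nth false (point_bits w x) (c * w + b) = odd (nth 0 x c %/ 2 ^ b).
Proof.
move=> + bw; elim: x c => //= a x IH [|c] cx; rewrite /point_bits /= nth_cat /bits size_mkseq.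
  by rewrite mul0n add0n bw nth_mkseq.
rewrite ltnNge mulSn -addnA leq_addr /= addKn; exact: IH.
Qed.

Lemma queried_wired x m : queried x k m -> wired (point_bits w (mkseq x k)) 0 m.
Proof.
move=> [_ q] i; rewrite addn0 => imm; rewrite /wires take0 /=.
have bw : i %% w < w by rewrite ltn_mod.
have ck : i %/ w < k by rewrite ltn_divLR// -mmE.
have := q _ ck _ bw; rewrite -addnA -divn_eq => ->.
by rewrite {3}(divn_eq i w) nth_point_bits ?size_mkseq// nth_mkseq.
Qed.

Definition result (m : nat -> nat) : Prop :=
  (exists x, [/\ point k ns x, forall i, i < k -> F x i = x i & holds_point x m]) \/
  (exists x y, [/\ point k ns x, point k ns y, forall i, i < k -> x i <= y i,
     exists2 j, j < k & F y j < F x j & holds_pair x y m]).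

Definition cost : nat := k * (16 * w + 12 * k + 100) + 25 * g + 100.

Lemma ok_body T e m lo hi A B Q :
  frame 1 e -> rep lo hi A B m -> search_inv k F fl ns lo hi A B ->
  (forall T' e' m' lo' hi' A' B', T' <= T + cost -> frame 1 e' ->
     rep lo' hi' A' B' m' -> search_inv k F fl ns lo' hi' A' B' ->
     meas k fl n w lo' hi' < meas k fl n w lo hi -> Q T' e' m') ->
  (forall T' e' m', T' <= T + cost -> frame 0 e' -> result m' -> Q T' e' m') ->
  ok M T body e m Q.
Proof.
move=> fe re I HQ1 HQ0; rewrite /body /cost in HQ1 HQ0 *.
have p2 : 2 ^ w <= 2 ^ w.+1 by rewrite leq_exp2l.
have p2' : 2 ^ w + 2 ^ w = 2 ^ w.+1 by rewrite addnn -mul2n -expnS.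
have nw := n_lt; have rg := inv_range nsn I; have le := inv_le I.
have px := inv_point I; set x := query fl lo hi in px *.
have pFx := pointF px.
have r3 := row_ge k; have Xk := X_ge.
(* Both ends are at most [n < 2 ^ w], so their sum before halving fits by [powM]. *)
step; apply: (ok_build_query fe re) => // [c ck|].
  by have [? ?] := rg c ck; have := le c ck; lia.
move=> T1 e1 m1 hT1 fe1 es o q; rewrite -/x in q.
have [q1 q2] := q; have re1 := rep_outside o re; have [in1 _ _ _ _] := re1.
step; apply: (ok_eval_gates (v0 := point_bits w (mkseq x k)) _ fe1 es) => //.
- by rewrite size_point_bits size_mkseq mmE.
- exact: queried_wired.
move=> T2 e2 m2 hT2 fe2 o2 wd.
have re2 : rep lo hi A B m2 by apply: rep_outside re1 => a ha; apply: o2; lia.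
have [in2 _ _ _ _] := re2.
have mx c : c < k -> m2 (X + c) = x c.
  by move=> ck; rewrite o2 ?q1//; lia.
step; apply: (ok_compare (x := x) (y := F x) fe2) => //.
- by move=> c ck; have := px c ck; have := nsn ck; lia.
- by move=> c ck; have := pFx c ck; have := nsn ck; lia.
- move=> c b ck bw; rewrite wd ?circF//; apply: os_wf.
  by have := leq_mul (ck : c.+1 <= k) (leqnn w); rewrite mulSn mmE; lia.
move=> T3 e3 hT3 fe3 fd; apply: ok_if => ef.
- case: fd => [[f0 _]|[j [_ jk [ej er] [eu ex] [fx ne]]]]; first by rewrite f0 in ef.
  have {jk}jk : j < k by lia.
  have rj := row_ge j; have rjk := row_lt jk.
  have [_ mlo mhi mA mB] := re2.
  have fx' i : i < j -> F x i = x i by move=> ij; apply: fx.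
  have xk : x j <= n by have := px j jk; have := nsn jk; lia.
  (* Restarting touches at most [k] rows of [2 * k] cells, the quadratic part of [cost]. *)
  have jj : j * (6 * k2 + 20) <= k * (12 * k + 20) by rewrite k2E; nia.
  apply: ok_if; rewrite eu => up; rewrite /move_up /move_down.
  + move: (fe3) ej er eu ex; open_frame e3; rewrite /= => -> -> -> ->.
    do 4 step; rewrite mhi//; do 2 step.
    apply: ok_if => /= xh.
    * do 7 step; apply: (@ok_copy _ _ _ _ _ X (row_addr j) k); rewrite //=; try lia.
      move=> tmp; do 10 step; rewrite ?addn0 ?addn1.
      apply: (@ok_descend _ 1 _ _ j) => //=; first by lia.
      move=> T4 e4 m4 hT4 fe4 /(rep_up jk re2 mx) re4.
      have I4 : search_inv k F fl ns (newbound j x (x j).+1 lo) (newbound j (B j) (hi j) hi)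
          (newrow j x A) (newrow j (B j) B) by apply: inv_up => //; rewrite -/x; lia.
      apply: (HQ1 _ _ _ _ _ _ _ _ fe4 re4 I4); first by lia.
      by apply: (meas_up nsn wn I I4) => //; rewrite -/x; lia.
    * do 4 step.
      apply: (@ok_emit_pair _ _ _ X (row_addr j + k)) => //=; try lia.
      move=> T4 e4 m4 hT4 fe4 h4; apply: HQ0 => //; first by lia.
      have [xB FB] : (forall i, i < k -> x i <= B j i) /\ F (B j) j < F x j.
        by apply: (violation_up I jk); rewrite -/x; lia.
      right; exists x, (B j); split=> //; first exact: (inv_B I).
        by exists j.
      case: h4 => h1 h2 h3; split=> // i ik; first by rewrite h2 ?mx.
      by rewrite h3 ?mB.
  + move: (fe3) ej er eu ex; open_frame e3; rewrite /= => -> -> -> ->.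
    do 4 step; rewrite mlo//; do 2 step.
    apply: ok_if => /= xh.
    * do 7 step; apply: (@ok_copy _ _ _ _ _ X (row_addr j + k) k); rewrite //=; try lia.
      move=> tmp; do 10 step; rewrite ?addn0 ?subn1.
      apply: (@ok_descend _ 1 _ _ j) => //=; first by lia.
      move=> T4 e4 m4 hT4 fe4 /(rep_down jk re2 mx) re4.
      have I4 : search_inv k F fl ns (newbound j (A j) (lo j) lo) (newbound j x (x j).-1 hi)
          (newrow j (A j) A) (newrow j x B) by apply: inv_down => //; rewrite -/x; lia.
      apply: (HQ1 _ _ _ _ _ _ _ _ fe4 re4 I4); first by lia.
      by apply: (meas_down nsn wn I I4) => //; rewrite -/x; lia.
    * do 4 step; rewrite ?addn0.
      apply: (@ok_emit_pair _ _ _ (row_addr j) X) => //=; try lia.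
      move=> T4 e4 m4 hT4 fe4 h4; apply: HQ0 => //; first by lia.
      have [xB FB] : (forall i, i < k -> A j i <= x i) /\ F x j < F (A j) j.
        by apply: (violation_down I jk); rewrite -/x; lia.
      right; exists (A j), x; split=> //; first exact: (inv_A I).
        by exists j.
      case: h4 => h1 h2 h3; split=> // i ik; first by rewrite h2 ?mA.
      by rewrite h3 ?mx.
- case: fd => [[_ fx]|[j [f1 _ _ _ _]]]; last by rewrite f1 in ef.
  apply: (ok_emit_point fe3) => T4 e4 m4 hT4 fe4 [h1 h2].
  apply: HQ0 => //; first by lia.
  left; exists x; split; [exact: px|by move=> i ik; apply: fx|].
  by split=> // i ik; rewrite h2 ?mx.
Qed.

(** The variant is one more than the measure, so that the round which finds the answer can still
    lower it, to [0]. The successor of [cost] pays for the loop test. *)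
Lemma ok_main_loop T e m lo hi A B Q :
  frame 1 e -> rep lo hi A B m -> search_inv k F fl ns lo hi A B ->
  (forall T' e' m', T' <= T + (meas k fl n w lo hi).+1 * cost.+1 + 1 -> result m' ->
     Q T' e' m') ->
  ok M T (While rRun body) e m Q.
Proof.
move=> fe re I HQ; set N := (meas _ _ _ _ _ _).+1 in HQ.
pose J v T' e' m' := T' + v * cost.+1 <= T + N * cost.+1 /\
  ((frame 0 e' /\ result m') \/
   [/\ frame 1 e' & exists lo' hi' A' B', [/\ v = (meas k fl n w lo' hi').+1,
      rep lo' hi' A' B' m' & search_inv k F fl ns lo' hi' A' B']]).
apply: (ok_while (I := J) (v := N)).
- by split=> //; right; split=> //; exists lo, hi, A, B.
- move=> v T' e' m' [hT [[fe' _]|[fe' [lo' [hi' [A' [B' [vE re' I']]]]]]]].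
    by move: fe'; open_frame e'.
  move=> _; apply: (ok_body fe' re' I').
    move=> T2 e2 m2 lo2 hi2 A2 B2 hT2 fe2 re2 I2 lt.
    exists (meas k fl n w lo2 hi2).+1; first by lia.
    split; last by right; split=> //; exists lo2, hi2, A2, B2.
    have := leq_mul (lt : (meas k fl n w lo2 hi2).+1 <= _) (leqnn cost.+1).
    move: hT; rewrite vE; lia.
  move=> T2 e2 m2 hT2 fe2 r2; exists 0; first by lia.
  by split; [move: hT; rewrite vE; lia|left].
- move=> v T' e' m' [hT [[fe' r]|[fe' _]]].
    by move=> _; apply: HQ => //; lia.
  by move: fe'; open_frame e'.
Qed.

(** * Initialisation and the complete program *)

Hypothesis flE : fl = k.+1 - w.
Hypothesis nE : n = \max_(i < k) ns i.
Hypothesis n_gt0 : 0 < n.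
Hypothesis inp_k : inp 0 = k.
Hypothesis inp_ns : forall i, i < k -> inp i.+1 = ns i.
Hypothesis inp_g : inp k.+1 = g.

Lemma ok_measure_instance T Q :
  (forall T' s p t u, T' <= T + k * 9 + w * 3 + 12 ->
    Q T' ([:: 0; 1; k; w] ++ nseq 10 0 ++ [:: 0; mm; p; 0; 0; s; t; u] ++ nseq 10 0) inp) ->
  ok M T measure_instance (nseq 32 0) inp Q.
Proof.
move=> HQ; have rk := row_ge k; rewrite /measure_instance /=.
have nw := n_lt.
have wM : w < 2 ^ w by rewrite ltn_expl.
have p2 : 2 ^ w <= 2 ^ w.+1 by rewrite leq_exp2l.
do 4 step; rewrite inp_k; do 2 step; rewrite addn0.
step; pose I v T' e' m' := exists t u,
  [/\ v <= k, T' + v * 6 = T + 3 + k * 6, m' = inp &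
  e' = [:: 0; 1; k; 0] ++ nseq 10 0 ++ [:: v; 0; k - v; 0; 0;
       \max_(i < k - v) ns i; t; u] ++ nseq 10 0].
apply: (ok_while (I := I) (v := k)).
- have uu : k - k = 0 by lia.
  by exists 0, 0; rewrite uu big_ord0 /=; split=> //; lia.
- move=> v T' e' m' [t [u [vk hT -> ->]]]; rewrite /=.
  case: v => // v in vk hT * => _.
  have kv : k - v = (k - v.+1).+1 by lia.
  set z := k - v.+1 in kv *; have zk : z < k by lia.
  have mxn : \max_(i < z.+1) ns i <= n.
    by apply/bigmax_leqP => i _; apply: nsn; have := ltn_ord i; lia.
  do 2 step; do 2 step; rewrite addn1 inp_ns//.
  rewrite big_ord_recr /= maxnE in mxn.
  do 5 step; exists v => //; exists (ns z), (ns z - \max_(i < z) ns i).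
  split=> //; try lia.
  by rewrite subn1 kv big_ord_recr /= maxnE.
move=> v T' e' m' [t [u [vk hT -> ->]]]; rewrite /= => v0.
rewrite v0 subn0 -nE in hT *.
step; pose J v T' e' m' := [/\ v <= w, T' + v * 3 <= T + 4 + k * 6 + w * 3, m' = inp &
  e' = [:: 0; 1; k; w - v] ++ nseq 10 0 ++ [:: 0; 0; k; 0; 0;
       n %/ 2 ^ (w - v); t; u] ++ nseq 10 0].
apply: (ok_while (I := J) (v := w)).
- have uu : w - w = 0 by lia.
  by rewrite /J uu divn1; split=> //; lia.
- move=> {HQ hT v0 v vk}v T2 e2 m2 [vw hT -> ->]; rewrite /=.
  case: v => [|v] in vw hT *; first by rewrite subn0 divn_small.
  move=> _; do 3 step; exists v => //; rewrite /J.
  have -> : w - v = (w - v.+1).+1 by lia.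
  by split=> //; try lia; rewrite addn1 expnSr divnMA divn2.
move=> {hT v0 v vk}v T2 e2 m2 [vw hT -> ->]; rewrite /= => nz.
(* Fewer than [w] halvings leave [n] positive. This needs [0 < n]: no halving happens at [0],
   whereas [bitlen 0 = 1]. *)
have {nz}v0 : v = 0.
  have [//|v0] := posnP v; move/eqP: nz; rewrite -leqn0 leqNgt divn_gt0 ?expn_gt0//.
  rewrite (leq_trans _ (trunc_logP (isT : 1 < 2) n_gt0))// leq_exp2l//.
  by rewrite wn /bitlen; lia.
rewrite v0 subn0 divn_small// in hT *.
do 2 step; pose K v T' e' m' := [/\ v <= k, T' + v * 3 <= T + 8 + k * 6 + w * 3 + k * 3,
  m' = inp &
  e' = [:: 0; 1; k; w] ++ nseq 10 0 ++ [:: v; (k - v) * w; k; 0; 0;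
       0; t; u] ++ nseq 10 0].
apply: (ok_while (I := K) (v := k)).
- have uu : k - k = 0 by lia.
  by rewrite /K uu !addn0; split=> //; lia.
- move=> {HQ hT v0 v vw}v T3 e3 m3 [vk hT -> ->]; rewrite /=.
  case: v => // v in vk hT * => _.
  have wv : (k - v) * w = (k - v.+1) * w + w by rewrite -mulSnr; congr (_ * _); lia.
  have : (k - v) * w <= mm by rewrite mmE leq_mul//; lia.
  rewrite wv => le.
  do 3 step; exists v => //; rewrite /K.
  by split=> //; try lia; rewrite wv subn1.
move=> {hT v0 v vw}v T3 e3 m3 [vk hT -> ->]; rewrite /= => v0.
rewrite v0 subn0 -mmE in hT *.
by apply: HQ; lia.
Qed.

Lemma ok_layout T s p t u Q :
  (forall T' p, T' <= T + k * 3 + 25 ->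
     Q T' (pers 0 ++ [:: 0; mm; p; 0; 0; s; t; u] ++ nseq 10 0) inp) ->
  ok M T layout ([:: 0; 1; k; w] ++ nseq 10 0 ++ [:: 0; mm; p; 0; 0; s; t; u] ++ nseq 10 0) inp Q.
Proof.
move=> HQ; have rk := row_ge k; rewrite /layout /=.
do 4 step; rewrite addn1 inp_g; do 24 step; rewrite ?addn0 ?addn1.
have -> : k.+2 + g + g + g + mm = V by lia.
have -> : V + mm + g = X by lia.
rewrite -LOE -HIE -k2E -gpE.
step; pose I v T' e' m' := [/\ v <= k, T' + v * 3 <= T + k * 3 + 22, m' = inp &
  e' = [:: 0; 1; k; w; g; gp; V; X; LO; HI; row_addr (k - v); k2; 0; 0] ++
       [:: v; mm; k.+1; 0; 0; s; t; u] ++ nseq 10 0].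
apply: (ok_while (I := I) (v := k)).
- have uu : k - k = 0 by lia.
  by rewrite /I uu /row_addr mul0n addn0; split=> //; lia.
- move=> v T' e' m' [vk hT -> ->]; rewrite /=.
  case: v => // v in vk hT * => _.
  have kv : k - v = (k - v.+1).+1 by lia.
  have rkv : row_addr (k - v) <= row_addr k by apply: row_le; lia.
  have rS := rowS (k - v.+1); rewrite -kv in rS.
  do 3 step; exists v => //; split=> //; try lia.
  by rewrite rS subn1.
move=> v T' e' m' [vk hT -> ->]; rewrite /= => v0.
rewrite v0 subn0 in hT *; step; rewrite -flE.
by apply: HQ; lia.
Qed.

Lemma ok_first_rows T e Q : frame 0 e -> 0 < k ->
  (forall T' e' m', T' <= T + k * (12 * k + 30) + 30 -> frame 1 e' ->
     rep (fun=> 1) ns (fun _ _ => 1) (fun=> ns) m' -> Q T' e' m') ->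
  ok M T first_rows e inp Q.
Proof.
move=> fe k0 HQ; have rk := row_ge k; have Xk := X_ge.
move: (fe); open_frame e; rewrite /first_rows /=.
have eM : End <= M by rewrite /End; lia.
do 4 step; rewrite ?addn0 /End.
step; match goal with |- ok _ _ _ ?E _ _ =>
  pose I v T' e' m' := [/\ v <= k, T' + v * 4 <= T + k * 4 + 3,
  e' = set_nth 0 (set_nth 0 E rA v) rDst (row_addr k + (k - v)) &
  m' = fun a => if row_addr k <= a < row_addr k + (k - v) then 1 else inp a] end.
apply: (ok_while (I := I) (v := k)).
- have uu : k - k = 0 by lia.
  rewrite /I uu /= !addn0; split=> //; try lia.
  by apply: funext => a; rewrite ifN//; lia.
- move=> v T' e' m' [vk hT -> ->]; rewrite /=.
  case: v => // v in vk hT * => _.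
  have kv : k - v = (k - v.+1).+1 by lia.
  do 5 step; exists v => //; rewrite /I kv subn1 /=; split=> //; try lia.
    by rewrite addn1 addnS.
  by apply: funext => a; rewrite /upd; case_ifs.
move=> v T' e' m' [vk hT -> ->]; rewrite /= => v0.
rewrite v0 subn0 in hT *.
do 5 step; apply: (@ok_copy _ _ _ _ _ 1 (row_addr k + k) k); rewrite //=; try lia.
move=> tmp; do 6 step; rewrite /End !addn0.
set m1 := blit _ _ _ _.
apply: (@ok_descend _ 1 _ _ k) => //.
move=> T2 e2 m2 hT2 fe2 [d1 d2 d3 d4]; apply: HQ => //.
  by move: hT2; rewrite k2E; nia.
have m1A i : i < k -> m1 (row_addr k + i) = 1.
  by move=> ik; rewrite /m1 blit_out ?ifT//; lia.
have m1B i : i < k -> m1 (row_addr k + k + i) = ns i.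
  by move=> ik; rewrite /m1 blit_in// ifN ?add1n ?inp_ns//; lia.
split.
- by move=> a aV; rewrite d1 /m1 ?blit_out ?ifN//; lia.
- by move=> c ck; rewrite d2// ck m1A.
- by move=> c ck; rewrite d3// ck m1B.
- by move=> c i ck ik; rewrite d4 ?ck ?m1A//; lia.
- by move=> c i ck ik; rewrite -addnA d4 ?ck ?addnA ?m1B//; lia.
Qed.

Definition total_cost : nat :=
  ((if fl != 0 then k * n else w ^ k).+1 * cost.+1 + k * (12 * k + 42) + w * 3 + 80).

Lemma ok_tarski_prog : 0 < k -> (forall i, i < k -> 0 < ns i) ->
  ok M 0 tarski_prog (nseq 32 0) inp (fun T e m => T <= total_cost /\ result m).
Proof.
move=> k0 ns0; rewrite /tarski_prog; step; apply: ok_measure_instance.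
move=> T1 s p t u hT1; step; apply: ok_layout => T2 {}p hT2.
step; apply: ok_first_rows => //.
move=> T3 e3 m3 hT3 fe3 re3.
have I : search_inv k F fl ns (fun=> 1) ns (fun _ _ => 1) (fun=> ns) by apply: inv_init.
apply: (ok_main_loop fe3 re3 I) => T4 e4 m4 hT4 r4; split=> //.
have ml := meas_le nsn wn I; rewrite /total_cost.
move: ml hT4; set S := meas _ _ _ _ _ _; set S' := if _ then _ else _ => ml hT4.
have := leq_mul (ml : S.+1 <= S'.+1) (leqnn cost.+1); lia.
Qed.

End Machine.

(** * From the machine to instances of the problem *)

Lemma size_gate_codes gs : size (flatten [seq gate_code g | g <- gs]) = 3 * size gs.
Proof. by elim: gs => //= g gs IH; rewrite size_cat IH; case: g => *; rewrite /=; lia. Qed.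

Lemma nth_gate_codes gs i b : i < size gs -> b < 3 ->
  nth 0 (flatten [seq gate_code g | g <- gs]) (3 * i + b)
  = nth 0 (gate_code (nth (GConst false) gs i)) b.
Proof.
move=> + b3; elim: gs i => //= g gs IH [|i] ig.
  by rewrite nth_cat muln0 add0n ifT//; case: g => *; rewrite /=; lia.
rewrite nth_cat; have -> : size (gate_code g) = 3 by case: g.
rewrite ifN; last by lia.
have -> : 3 * i.+1 + b - 3 = 3 * i + b by lia.
exact: IH.
Qed.

Lemma all_gate_codes (P : pred nat) gs :
  all P (flatten [seq gate_code g | g <- gs]) = all (fun g => all P (gate_code g)) gs.
Proof. by elim: gs => //= g gs IH; rewrite all_cat IH. Qed.

Section Instance.
Variables (k : nat) (ns : k.-tuple nat) (f : lattice ns -> lattice ns) (c : circuit).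
Hypothesis k3 : 3 <= k.
Hypothesis ns_gt0 : forall i : 'I_k, 0 < tnth ns i.
Hypothesis pres : presents c f.

Let n := side ns.
Let w := bitlen n.
Let g := circuit_size c.
Let nsf := nth 0 ns.

Lemma nth_ns (i : 'I_k) : nsf i = tnth ns i.
Proof. by rewrite /nsf (tnth_nth 0). Qed.

Lemma nsf_gt0 i : i < k -> 0 < nsf i.
Proof. by move=> ik; rewrite (nth_ns (Ordinal ik)). Qed.

Lemma nsf_le i : i < k -> nsf i <= n.
Proof. by move=> ik; rewrite (nth_ns (Ordinal ik)) /n /side; apply: leq_bigmax. Qed.

Lemma bottom_in : in_lattice ns [tuple 1 | i < k].
Proof. by apply/forallP => i; rewrite tnth_mktuple leqnn ns_gt0. Qed.

(** Falls back to the bottom when [x] is not in the lattice, so that [f] becomes a total map on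
    functions. *)
Definition lattice_point (x : nat -> nat) : lattice ns :=
  insubd (exist (fun x => in_lattice ns x) _ bottom_in) [tuple x i | i < k].

Lemma val_lattice_point x : point k nsf x -> sval (lattice_point x) = [tuple x i | i < k].
Proof.
move=> px; apply: (@insubdK _ (in_lattice ns)).
by apply/forallP => i; rewrite tnth_mktuple -nth_ns; apply: px.
Qed.

Lemma tnth_lattice_point x i : point k nsf x -> tnth (sval (lattice_point x)) i = x i.
Proof. by move=> px; rewrite val_lattice_point// tnth_mktuple. Qed.

Lemma lattice_point_seq x : point k nsf x -> sval (lattice_point x) = mkseq x k :> seq nat.
Proof.
move=> px; rewrite val_lattice_point//.
have sz : size [tuple x i | i < k] = size (mkseq x k) by rewrite size_mkseq size_tuple.
apply: (eq_from_nth (x0 := 0) sz) => i; rewrite size_tuple => ik; rewrite nth_mkseq//.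
by have := tnth_nth 0 [tuple x i | i < k] (Ordinal ik); rewrite tnth_mktuple.
Qed.

Definition coord_map (x : nat -> nat) (i : nat) : nat :=
  nth 0 (sval (f (lattice_point x))) i.

Lemma point_coord_map x : point k nsf x -> point k nsf (coord_map x).
Proof.
move=> px i ik; have /forallP/(_ (Ordinal ik)) := svalP (f (lattice_point x)).
by rewrite -nth_ns (tnth_nth 0).
Qed.

Lemma circuit_coord_map x : point k nsf x -> forall a b, a < k -> b < w ->
  nth false (wires (gates c) (point_bits w (mkseq x k)) g) (nth 0 (outs c) (a * w + b))
  = odd (coord_map x a %/ 2 ^ b).
Proof.
move=> px a b ak bw; have [[_ so _] ev] := pres.
have := congr1 (fun s => nth false s (a * w + b)) (ev (lattice_point x)).
have ab : a * w + b < k * w.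
  by have := leq_mul (ak : a.+1 <= k) (leqnn w); rewrite mulSn; lia.
rewrite nth_point_bits ?size_tuple// -/(coord_map x a) => <-.
rewrite /circuit_eval (nth_map 0) ?so// lattice_point_seq//.
by rewrite /wires /g /circuit_size take_size.
Qed.

Definition layout_end (k w g : nat) : nat :=
  k.+2 + 3 * g + k * w + (k * w + g) + k + k + k + k * (k + k) + (k + k).

(** The summands cover the addresses, the sum of two coordinates, and the opcodes of gates. *)
Definition value_bound : nat := layout_end k w g + 2 ^ w.+1 + 3.

Let inp := nth 0 (instance_code ns c).

Lemma inp_gates i : i < 3 * g + size (outs c) ->
  inp (k.+2 + i) = nth 0 (flatten [seq gate_code g | g <- gates c] ++ outs c) i.
Proof.
move=> ik; rewrite /inp /instance_code /= nth_cat size_tuple ifN; last by lia.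
by have -> : (k + i).+1 - k = i.+1 by lia.
Qed.

Lemma inp_bounded a : inp a <= value_bound.
Proof.
have [[wf so /allP ao] _] := pres.
have nw : n < 2 ^ w by rewrite /w /bitlen; apply: trunc_log_ltn.
have p2 : 2 ^ w <= 2 ^ w.+1 by rewrite leq_exp2l.
have h : all (fun v => v <= value_bound) (instance_code ns c).
  rewrite /instance_code /value_bound /layout_end /= all_cat /= all_cat.
  apply/and5P; split; try by rewrite -/g; lia.
  - apply/(all_nthP 0) => i; rewrite size_tuple => /nsf_le; rewrite /nsf; lia.
  - rewrite all_gate_codes; apply/(all_nthP (GConst false)) => j jg /=.
    have := wf j jg; rewrite -/(circuit_size c) -/g -/n -/w in jg *.
    by case: nth => [[]|b|b b'|b b'] /= h; rewrite ?andbT; lia.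
  - by apply/allP => v /ao; rewrite -/(circuit_size c) -/g -/n -/w; lia.
case: (ltnP a (size (instance_code ns c))) => ha; last by rewrite /inp nth_default.
exact: (all_nthP 0 h).
Qed.

Lemma tarski_prog_correct : exists (s : state) (t : nat) (a : answer ns),
  [/\ exec tarski_prog (init_state (instance_code ns c)) s t,
      holds_output s (answer_code a), tarski_solution f a
    & t <= total_cost k w g (k.+1 - w) n * (2 * bitlen value_bound)].
Proof.
have [[wf so /allP ao] _] := pres.
have H := @ok_tarski_prog value_bound k w g (k.+1 - w) (k * w) k.+2
  (k.+2 + 3 * g + k * w) (k.+2 + 3 * g + k * w + k * w + g)
  (k.+2 + 3 * g + k * w + k * w + g + k) (k.+2 + 3 * g + k * w + k * w + g + k + k)
  (k + k) inp erefl erefl erefl erefl erefl erefl erefl.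
have gE : size (gates c) = g by [].
have n0 : 0 < n.
  by apply: leq_trans (nsf_le (ltnW (ltnW k3))); apply: nsf_gt0; lia.
have : ok value_bound 0 tarski_prog (nseq 32 0) inp
    (fun T e m => T <= total_cost k w g (k.+1 - w) n /\ result k nsf coord_map m).
  apply: (H _ _ (gates c) (outs c)) => //.
  - by rewrite /row_addr /value_bound /layout_end; lia.
  - by rewrite /value_bound; lia.
  - move=> i b ig b3; rewrite -addnA inp_gates; last by rewrite -/g; lia.
    rewrite nth_cat size_gate_codes gE ifT ?nth_gate_codes ?gE//; lia.
  - by move=> i ik; rewrite -/g; apply: ao; rewrite mem_nth ?so.
  - move=> i ik; rewrite -addnA inp_gates; last by rewrite so ltn_add2l.
    by rewrite nth_cat size_gate_codes gE ifN ?addKn//; lia.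
  - exact: nsf_le.
  - exact: point_coord_map.
  - exact: circuit_coord_map.
  - by rewrite /value_bound; lia.
  - by rewrite /n /side; apply: eq_bigr => i _; rewrite nth_ns.
  - by move=> i ik; rewrite /inp /instance_code /= nth_cat size_tuple ik.
  - by rewrite /inp /instance_code /= nth_cat size_tuple ltnn subnn.
  - by lia.
  - exact: nsf_gt0.
case=> [|e [m [t [N [E tN _ [NT r]]]]]].
  by split; [rewrite all_nseq orbT|exact: inp_bounded].
have Ei : mach (nseq 32 0) inp = init_state (instance_code ns c).
  by congr State; apply: funext => i; rewrite nth_nseq if_same.
rewrite Ei in E; exists (mach e m), t.
have tb : t <= total_cost k w g (k.+1 - w) n * (2 * bitlen value_bound).
  by apply: leq_trans tN _; rewrite leq_mul// -[N]add0n.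
case: r => [[x [px fx [m0 mx]]]|[x [y [px py xy [j jk lt] [m0 mx my]]]]].
- exists (T1 (lattice_point x)); split=> //.
  + move=> [|i] //= ik; rewrite mx; last by move: ik; rewrite /= size_tuple.
    by rewrite lattice_point_seq// nth_mkseq//; move: ik; rewrite /= size_tuple.
  + rewrite /=; apply: val_inj => /=; apply: eq_from_tnth => i.
    by rewrite tnth_lattice_point// -fx// (tnth_nth 0).
- exists (T2 (lattice_point x) (lattice_point y)); split=> //.
  + move=> [|i] //=; rewrite size_cat !size_tuple ltnS => ik.
    rewrite !lattice_point_seq// nth_cat size_mkseq; case: ltnP => ik'.
      by rewrite mx ?nth_mkseq.
    rewrite nth_mkseq; last by lia.
    by rewrite -my; [congr m|]; lia.
  + split; first by move=> i; rewrite !tnth_lattice_point// xy.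
    move=> /(_ (Ordinal jk)); rewrite !(tnth_nth 0) /=.
    by move: lt; rewrite /coord_map; lia.
Qed.

End Instance.

(** * Estimates of the running time *)

(** Taking the logarithm turns [2 ^ w.+1] into a term linear in [w], which keeps the cost of an
    instruction polynomial. For the addresses the crude [E < 2 ^ E] is enough. *)
Lemma bitlen_value_bound k w g :
  bitlen (layout_end k w g + 2 ^ w.+1 + 3) <= layout_end k w g + w + 4.
Proof.
move: (layout_end k w g) => E; rewrite /bitlen.
have -> : E + w + 4 = (trunc_log 2 (2 ^ (E + w + 3))).+1.
  by rewrite trunc_expnK//; lia.
rewrite ltnS; apply: leq_trunc_log.
have e1 : E < 2 ^ E by rewrite ltn_expl.
have e2 : 0 < 2 ^ w by rewrite expn_gt0.
rewrite !expnD (expnS 2 w) -[2 ^ 3]/8; move: e1 e2; move: (2 ^ E) (2 ^ w) => a b e1 e2.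
have h1 : a <= a * b by rewrite leq_pmulr.
have h2 : b <= a * b by rewrite leq_pmull//; lia.
by lia.
Qed.

Lemma total_cost_le k w g fl n (s := k + w + g + 1) :
  total_cost k w g fl n <= (if fl != 0 then k * n else w ^ k).+1 * (400 * (s * s)).
Proof.
rewrite /total_cost /cost; set S := if _ then _ else _.
have h : k * (16 * w + 12 * k + 100) + 25 * g + 101 + k * (12 * k + 42) + w * 3 + 80
    <= 400 * (s * s) by rewrite /s; nia.
have := leq_mul (leqnn S.+1) h; nia.
Qed.

Lemma layout_end_le k w g (s := k + w + g + 1) :
  2 * (layout_end k w g + w + 4) <= 100 * (s * s).
Proof. by rewrite /layout_end /s; nia. Qed.

Import Order.TTheory GRing.Theory Num.Theory.

Section Bounds.
Local Open Scope ring_scope.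
Variable R : realType.

Lemma ln2_gt0 : 0 < ln 2 :> R.
Proof. by rewrite ln_gt0// ltr1n. Qed.

Lemma le_log2 (a n : nat) : (2 ^ a <= n)%N -> a%:R <= log2 R n.
Proof.
move=> an; rewrite /log2 ler_pdivlMr ?ln2_gt0// mulr_natl -lnXn//.
rewrite ler_ln ?posrE ?exprn_gt0// -?natrX ?ler_nat// ltr0n.
by apply: leq_trans an; rewrite expn_gt0.
Qed.

Lemma log2_ge1 n : (2 <= n)%N -> 1 <= log2 R n.
Proof. by move=> n2; apply: (@le_log2 1). Qed.

Lemma bitlen_log2 n : (0 < n)%N -> (bitlen n)%:R <= log2 R n + 1.
Proof.
by move=> n0; rewrite /bitlen -natr1 lerD2r le_log2// trunc_logP.
Qed.

(** Rests on [1 + 1 / L <= expR (1 / L)]; the [k]-th power of the right side is at most [expR 1]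
    since [k <= L]. *)
Lemma succ_exp_le (L : R) k : 1 <= L -> k%:R <= L -> (L + 1) ^+ k <= expR 1 * L ^+ k.
Proof.
move=> L1 kL; have L0 : 0 < L by lra.
have -> : L + 1 = (1 + L^-1) * L by rewrite mulrDl mul1r mulVf ?gt_eqF.
have L0' := ltW L0; rewrite exprMn; apply: ler_wpM2r; first exact: exprn_ge0.
apply: (@le_trans _ _ (expR L^-1 ^+ k)).
  by rewrite lerXn2r ?nnegrE ?expR_ge0 ?expR_ge1Dx// addr_ge0 ?invr_ge0.
by rewrite -expRM_natl ler_expR ler_pdivrMr// mul1r.
Qed.

(** The factors [k] and [L] kept apart from [L ^+ (k - 1)] are meant for the polynomial: [L] for the
    surplus power of the binary search, [k] for the length of the Kleene iteration. The constant
    exceeds both [expR 1 + 1] and [4 + 1], which the two regimes require. *)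
Lemma queries_le k n (w := bitlen n) (L := log2 R n) : (3 <= k)%N -> (2 <= n)%N ->
  (if (k.+1 - w)%N != 0%N then (k * n)%N else (w ^ k)%N).+1%:R
  <= (expR 1 + 6) * (k%:R * L * L ^+ (k - 1)).
Proof.
move=> k3 n2; have n0 : (0 < n)%N by lia.
have L1 : 1 <= L by exact: log2_ge1.
have e0 : 0 <= expR 1 :> R := expR_ge0 _.
have k1 : 1 <= k%:R :> R by rewrite ler1n; lia.
have P1 : 1 <= L ^+ (k - 1) by rewrite exprn_ege1.
have Lk : L ^+ k = L * L ^+ (k - 1) by rewrite -exprS; congr (_ ^+ _); lia.
set P := L ^+ (k - 1) in P1 Lk *.
case: eqP => /= [wk|/eqP wk].
  (* [k < w] says that [k <= trunc_log 2 n], that is, [2 ^ k <= n]. *)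
  have kL : k%:R <= L.
    apply: le_log2; apply: leq_trans (trunc_logP (isT : (1 < 2)%N) n0).
    by rewrite leq_exp2l//; move: wk; rewrite /w /bitlen; lia.
  have wL : (w ^ k)%N%:R <= expR 1 * (L * P).
    rewrite -Lk; apply: le_trans (succ_exp_le L1 kL).
    by rewrite natrX lerXn2r ?nnegrE ?bitlen_log2//; lra.
  rewrite -natr1.
  have LP : 1 <= L * P by rewrite -[1]mulr1 ler_pM.
  have kLP : L * P <= k%:R * L * P by rewrite -mulrA ler_peMl//; lra.
  by have := ler_wpM2l e0 kLP; lra.
have nP : n%:R <= 4 * P.
  (* Below [4] the logarithm may be less than [2], so its powers need not dominate those of [2];
     there [1 <= P] and the constant [4] suffice. *)
  case: (leqP n 3) => n3.
    have : n%:R <= 3 :> R by rewrite (ler_nat _ n 3).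
    by lra.
  have L2 : 2 <= L by apply: (@le_log2 2).
  have nk : (n <= 2 * 2 ^ (k - 1))%N.
    rewrite -expnS; apply: ltnW; apply: leq_trans (trunc_log_ltn n (isT : (1 < 2)%N)) _.
    by rewrite leq_exp2l//; move: wk; rewrite /w /bitlen; lia.
  have : n%:R <= 2 * 2 ^+ (k - 1) :> R by rewrite -natrX -natrM ler_nat.
  have : 2 ^+ (k - 1) <= P by rewrite lerXn2r ?nnegrE//; lra.
  by have := exprn_ge0 (k - 1) (ler0n R 2); lra.
rewrite -natr1 natrM.
have kP : P <= k%:R * P by rewrite ler_peMl//; lra.
have kLP : k%:R * P <= k%:R * L * P by rewrite -mulrA ler_wpM2l ?ler_peMl//; lra.
have knP : k%:R * n%:R <= k%:R * (4 * P) by rewrite ler_wpM2l.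
have : 0 <= expR 1 * (k%:R * L * P) by rewrite mulr_ge0//; lra.
by lra.
Qed.

Lemma eval2D (p q : {poly {poly R}}) x y : eval2 (p + q) x y = eval2 p x y + eval2 q x y.
Proof. by rewrite /eval2 !hornerD. Qed.

Lemma eval2M (p q : {poly {poly R}}) x y : eval2 (p * q) x y = eval2 p x y * eval2 q x y.
Proof. by rewrite /eval2 !hornerM. Qed.

Lemma eval2X (p : {poly {poly R}}) x y m : eval2 (p ^+ m) x y = eval2 p x y ^+ m.
Proof. by rewrite /eval2 !horner_exp. Qed.

Lemma eval2_fst x y : eval2 ('X : {poly {poly R}}) x y = x.
Proof. by rewrite /eval2 hornerX hornerC. Qed.

Lemma eval2_snd x y : eval2 (('X)%:P : {poly {poly R}}) x y = y.
Proof. by rewrite /eval2 hornerC hornerX. Qed.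

Lemma eval2_1 x y : eval2 (1 : {poly {poly R}}) x y = 1.
Proof. by rewrite /eval2 hornerC hornerC. Qed.

End Bounds.

Theorem theorem18 (R : realType) :
  exists A : prog,
    (forall (k : nat) (ns : k.-tuple nat) (f : lattice ns -> lattice ns)
            (c : circuit),
       3 <= k -> (forall i : 'I_k, 0 < tnth ns i) -> presents c f ->
       exists (s : state) (t : nat) (a : answer ns),
         [/\ exec A (init_state (instance_code ns c)) s t,
             holds_output s (answer_code a)
           & tarski_solution f a]) /\
    (forall q : {poly {poly R}},
       exists (C : R) (p : {poly {poly R}}),
         forall (k : nat) (ns : k.-tuple nat) (f : lattice ns -> lattice ns)
                (c : circuit),
           3 <= k -> (forall i : 'I_k, 0 < tnth ns i) -> 2 <= side ns ->
           presents c f ->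
           ((circuit_size c)%:R <= eval2 q (log2 R (side ns)) k%:R)%R ->
           forall (s : state) (t : nat),
             exec A (init_state (instance_code ns c)) s t ->
             (t%:R <= C * (eval2 p (log2 R (side ns)) k%:R
                           * log2 R (side ns) ^+ (k - 1)))%R).
Proof.
exists tarski_prog; split.
  move=> k ns f c k3 ns0 pr.
  by have [s [t [a [E h sol _]]]] := tarski_prog_correct k3 ns0 pr; exists s, t, a.
move=> q; exists (400 * 100 * (expR 1 + 6))%R.
(* The outer ['X] evaluates to the logarithm, [('X)%:P] to [k]. The first two factors come from
   [queries_le]. The fourth power is a square for the steps per round times a square for the bit
   length per step; [q] stands for the circuit size. *)
exists (('X)%:P * 'X * (('X)%:P + 'X + q + 1 + 1) ^+ 4)%R.
move=> k ns f c k3 ns0 n2 pr gq s t Et.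
have [s' [t' [a [E' _ _ tb]]]] := tarski_prog_correct k3 ns0 pr.
(* Determinism carries the bound from the run constructed above to the given one. *)
have [_ tt] := exec_det Et E'; rewrite -{}tt {s' t' a E' Et} in tb.
move: tb; set n := side ns in n2 gq *; set w := bitlen n; set g := circuit_size c in gq *.
set S := (if (k.+1 - w)%N != 0 then k * n else w ^ k).+1 => tb.
pose u := k + w + g + 1.
have {}tb : t <= S * (400 * 100 * u ^ 4).
  apply: leq_trans tb _; rewrite -/u.
  have h1 := total_cost_le k w g (k.+1 - w) n.
  have h2 := leq_trans (leq_mul (leqnn 2) (bitlen_value_bound k w g)) (layout_end_le k w g).
  apply: leq_trans (leq_mul h1 h2) _; rewrite -/u -/S -mulnA leq_mul//.
  by rewrite mulnACA leq_mul// !expnS expn0 muln1 !mulnA.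
rewrite !(eval2M, eval2D, eval2X, eval2_fst, eval2_snd, eval2_1).
have := queries_le R k3 n2; rewrite -/w -/S.
set L := log2 R n in gq *; set Pk := (L ^+ (k - 1))%R => Sb.
have L1 : (1 <= L)%R by exact: log2_ge1.
set G := eval2 q L k%:R in gq *.
have ub : (u%:R <= k%:R + L + G + 1 + 1)%R.
  have := @bitlen_log2 R n (ltnW n2); rewrite -/w -/L /u !natrD; lra.
have U4 : (u%:R ^+ 4 <= (k%:R + L + G + 1 + 1) ^+ 4)%R.
  by rewrite lerXn2r ?nnegrE//; apply: le_trans ub.
move: tb; rewrite -(ler_nat R) natrM natrM natrX natrM => tb; apply: le_trans tb _.
set U := (_ ^+ 4)%R in U4 *; set B := (_ ^+ 4)%R in U4 *.
have -> : (400 * 100 * (expR 1 + 6) * (k%:R * L * B * Pk)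
  = ((expR 1 + 6) * (k%:R * L * Pk)) * (400 * 100 * B))%R by ring.
have c0 : (0 <= 400 * 100 :> R)%R by rewrite mulr_ge0 ?ler0n.
apply: ler_pM; [exact: ler0n| |exact: Sb|exact: ler_wpM2l].
by apply: mulr_ge0 => //; apply: exprn_ge0; exact: ler0n.
Qed.
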